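(* Let $X\subseteq \mathbb{R}^n$ be a closed set supporting a doubling Radon measure $\mu_0$. Suppose that a non-trivial Radon measure $\mu\ll\mu_0$ on $X$ supports $k$ independent Alberti representations, for some integer $k\geq 1$. Then for $\mu$-almost every $x\in X$ there is a $k$-dimensional vector subspace $V\subseteq\mathbb{R}^n$ with the following property: every intrinsic tangent $Y\in \mathrm{Tan}_{\mathbb{R}^n}(X,x)$ is a product $Y=Z\times V$ (i.e. $Y=\{z+v: z\in Z, v\in V\}$) for some closed set $Z\subseteq V^{\perp}\subseteq\mathbb{R}^n$.
   Context: A Radon measure $\mu$ on a metric space, finite and positive on balls, is doubling if there is $C$ with $\mu(B(x,2r))\le C\mu(B(x,r))$ for all $x$, $r>0$; a set ''supports'' $\mu$ if $\mu$ is such a measure on it. $V^\perp$ is the orthogonal complement of $V$. Fragments and Alberti representations: Let $X$ be a complete, separable, locally compact metric space. A fragment in $X$ is a bi-Lipschitz map $\gamma\colon C\to X$ where $C\subseteq\mathbb{R}$ is compact with $\mathcal{L}^1(C)>0$; write $\mathrm{dom}(\gamma)=C$, $\mathrm{im}(\gamma)=\gamma(C)$. $\mathrm{Frag}(X)$ is the set of fragments, topologized as a subspace of the space of nonempty compact subsets of $\mathbb{R}\times X$ with the Hausdorff metric via $\gamma\mapsto\{(t,\gamma(t)):t\in\mathrm{dom}(\gamma)\}$. For $f\colon X\to\mathbb{R}^m$ and $t$ a Lebesgue density point of $C=\mathrm{dom}(\gamma)$, $(f\circ\gamma)'(t)=\lim_{t'\to t,\,t'\in C}\frac{f(\gamma(t'))-f(\gamma(t))}{t'-t}$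 when the limit exists. $M(X)$ denotes the Radon measures on $X$ with the weak-* topology (as dual of compactly supported continuous functions). An Alberti representation of a Radon measure $\mu$ on $X$ is a pair $(P,\nu)$ where $P$ is a Radon probability measure on $\mathrm{Frag}(X)$, $\nu\colon\mathrm{Frag}(X)\to M(X)$, $\gamma\mapsto\nu_\gamma$, is Borel with $\nu_\gamma\ll\mathcal{H}^1|_{\mathrm{im}(\gamma)}$ for every $\gamma$, $\mu(A)=\int_{\mathrm{Frag}(X)}\nu_\gamma(A)\,dP(\gamma)$ for every Borel $A\subseteq X$, and for every Borel $A\subseteq X$ and compact interval $I\subseteq\mathbb{R}$ the map $\gamma\mapsto\nu_\gamma(A\cap\gamma(\mathrm{dom}(\gamma)\cap I))$ is Borel. A cone in $\mathbb{R}^m$ is a set $\mathrm{Cone}(w,t)=\{v\in\mathbb{R}^m: v\neq0,\ v\cdot w\ge t|v|\}$ with $w\in\mathbb{S}^{m-1}$, $t\in\mathbb{R}$. For Lipschitz $\phi\colon X\to\mathbb{R}^m$ and a cone $C$, a fragment $\gamma$ is in the $\phi$-direction of $C$ if $(\phi\circ\gamma)'(t)\in C$ for a.e. $t\in\mathrm{dom}(\gamma)$, and an Alberti representation $(P,\nu)$ is in the $\phi$-direction of $C$ if $P$-a.e. fragment is. Cones $C_1,\dots,C_k$ are independent if every choice $v_i\in C_i$ ($i=1,\dots,k$) is linearly independent. Alberti representations $\mathcal{A}_1,\dots,\mathcal{A}_k$ of $\mu$ are $\phi$-independent if there are independent cones $C_1,\dots,C_k$ in $\mathbb{R}^m$ with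 each $\mathcal{A}_i$ in the $\phi$-direction of $C_i$; they are independent if they are $\phi$-independent for some Lipschitz $\phi\colon X\to\mathbb{R}^m$ (some $m$). Intrinsic tangents: for $A,B\subseteq\mathbb{R}^n$ and $R>0$, $d_R(A,B)=\max\{\sup_{a\in A\cap B(0,R)}\mathrm{dist}(a,B),\ \sup_{b\in B\cap B(0,R)}\mathrm{dist}(b,A)\}$; sets $A_j$ converge in the pointed Hausdorff sense to a closed set $A$ if $d_R(A_j,A)\to0$ for every $R>0$. For $A\subseteq\mathbb{R}^n$ and $a\in A$, an intrinsic tangent of $A$ at $a$ is any closed set that is a pointed Hausdorff limit of $\lambda_j^{-1}(A-a)$ for some sequence $\lambda_j\to0^+$; $\mathrm{Tan}_{\mathbb{R}^n}(A,a)$ is the set of these. *)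

(* Defs.v *)
From HB Require Import structures.
From mathcomp Require Import all_boot all_order all_algebra.
From mathcomp Require Import all_classical all_reals all_analysis.
From mathcomp Require Import measurable_realfun.
Import Order.TTheory GRing.Theory Num.Theory numFieldNormedType.Exports.
Unset Printing Implicit Defensive.
Local Open Scope classical_set_scope.
Local Open Scope ring_scope.

Definition dotv {R : realType} {m : nat} (u v : 'rV[R]_m) : R :=
  \sum_(i < m) u 0 i * v 0 i.
Definition enorm {R : realType} {m : nat} (v : 'rV[R]_m) : R :=
  Num.sqrt (dotv v v).
Definition edist {R : realType} {m : nat} (x y : 'rV[R]_m) : R :=
  enorm (x - y).
Definition eball {R : realType} {m : nat} (x : 'rV[R]_m) (r : R) :
  set 'rV[R]_m := [set y | edist x y < r].

Definition BorRn (R : realType) (n : nat) :=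
  g_sigma_algebraType (open : set (set 'rV[R]_n)).

Notation meas R n := {measure set (BorRn R n) -> \bar R}.

(* A Radon measure on the closed set X ⊆ R^n, viewed as a Borel measure
   on R^n concentrated on X: it vanishes off X, is finite on compact
   subsets of X and is inner regular by compact sets. *)
Definition radon_on {R : realType} {n : nat} (X : set 'rV[R]_n)
    (mu : meas R n) : Prop :=
  [/\ mu (~` X) = 0%E,
      (forall K : set 'rV[R]_n, compact K -> K `<=` X -> (mu K < +oo)%E)
    & (forall A : set (BorRn R n), measurable A ->
        mu A = ereal_sup [set mu K | K in
                          [set K : set 'rV[R]_n | compact K /\ K `<=` A]])].

Definition doubling_on {R : realType} {n : nat} (X : set 'rV[R]_n)
    (mu : meas R n) : Prop :=
  [/\ radon_on X mu,
      (forall x r, X x -> 0 < r ->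
         (0 < mu (eball x r))%E /\ (mu (eball x r) < +oo)%E)
    & exists C : R, forall x r, X x -> 0 < r ->
         (mu (eball x (2 * r)) <= C%:E * mu (eball x r))%E].

Definition ediam {R : realType} {n : nat} (F : set 'rV[R]_n) : \bar R :=
  ereal_sup ([set (edist p.1 p.2)%:E | p in F `*` F] `|` [set 0%E]).

Definition hausdorff1_delta {R : realType} {n : nat} (d : R)
    (A : set 'rV[R]_n) : \bar R :=
  ereal_inf [set (\sum_(0 <= i <oo) ediam (F i))%E | F in
     [set F : nat -> set 'rV[R]_n |
        A `<=` \bigcup_i F i /\ forall i, (ediam (F i) <= d%:E)%E]].

Definition hausdorff1 {R : realType} {n : nat} (A : set 'rV[R]_n) : \bar R :=
  ereal_sup [set hausdorff1_delta d A | d in [set d : R | 0 < d]].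

(* Fragments, identified with their graphs {(t, gamma t) : t in C}.    *)
Definition frag_dom {R : realType} {n : nat} (G : set (R * 'rV[R]_n)) : set R :=
  [set t | exists y, G (t, y)].
Definition frag_img {R : realType} {n : nat} (G : set (R * 'rV[R]_n)) :
  set 'rV[R]_n := [set y | exists t, G (t, y)].

Definition is_fragment {R : realType} {n : nat} (X : set 'rV[R]_n)
    (G : set (R * 'rV[R]_n)) : Prop :=
  exists (C : set R) (g : R -> 'rV[R]_n),
    [/\ compact C, (0 < (lebesgue_measure : set R -> \bar R) C)%E,
        g @` C `<=` X,
        (exists L : R, 0 < L /\ forall s t, C s -> C t ->
            `|s - t| <= L * edist (g s) (g t) /\ edist (g s) (g t) <= L * `|s - t|)
      & G = [set (t, g t) | t in C]].

Definition FragX {R : realType} {n : nat} (X : set 'rV[R]_n) :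
  set (set (R * 'rV[R]_n)) := [set G | is_fragment X G].

Definition pdist {R : realType} {n : nat} (p q : R * 'rV[R]_n) : R :=
  Num.max `|p.1 - q.1| (edist p.2 q.2).
Definition hdist {R : realType} {n : nat} (A B : set (R * 'rV[R]_n)) : \bar R :=
  maxe (ereal_sup [set ereal_inf [set (pdist a b)%:E | b in B] | a in A])
       (ereal_sup [set ereal_inf [set (pdist a b)%:E | a in A] | b in B]).

Definition frag_open {R : realType} {n : nat} (X : set 'rV[R]_n)
    (U : set (set (R * 'rV[R]_n))) : Prop :=
  U `<=` FragX X /\
  forall G, U G -> exists2 r : R, 0 < r &
    forall G', FragX X G' -> (hdist G G' < r%:E)%E -> U G'.

Definition hopen {R : realType} {n : nat} (U : set (set (R * 'rV[R]_n))) : Prop :=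
  forall G, U G -> exists2 r : R, 0 < r &
    forall G', (hdist G G' < r%:E)%E -> U G'.
Definition hcompact {R : realType} {n : nat} (K : set (set (R * 'rV[R]_n))) : Prop :=
  forall (I : Type) (U : I -> set (set (R * 'rV[R]_n))),
    (forall i, hopen (U i)) -> K `<=` \bigcup_i U i ->
    exists J : set I, finite_set J /\ K `<=` \bigcup_(i in J) U i.

Definition FragT {R : realType} {n : nat} (X : set 'rV[R]_n) :=
  g_sigma_algebraType (frag_open X).

Definition radon_prob {R : realType} {n : nat} (X : set 'rV[R]_n)
    (P : probability (FragT X) R) : Prop :=
  P (FragX X : set (FragT X)) = 1%E /\
  forall A : set (FragT X), measurable A -> A `<=` FragX X ->
    P A = ereal_sup [set P K | K in
            [set K : set (FragT X) | hcompact K /\ K `<=` A]].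

Definition Cc {R : realType} {n : nat} (X : set 'rV[R]_n) (f : 'rV[R]_n -> R) : Prop :=
  {within X, continuous f} /\
  exists K : set 'rV[R]_n, [/\ compact K, K `<=` X &
                               forall x, X x -> ~ K x -> f x = 0].

Definition MX {R : realType} {n : nat} (X : set 'rV[R]_n) : set (meas R n) :=
  [set nu | radon_on X nu].

Definition wstar_open {R : realType} {n : nat} (X : set 'rV[R]_n)
    (W : set (meas R n)) : Prop :=
  W `<=` MX X /\
  forall mu, W mu -> exists (p : nat) (fs : 'I_p -> ('rV[R]_n -> R)) (e : R),
    [/\ 0 < e, (forall i, Cc X (fs i)) &
      forall nu, MX X nu ->
        (forall i, (`| \int[nu]_(x in X) (fs i x)%:E
                      - \int[mu]_(x in X) (fs i x)%:E | < e%:E)%E) ->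
        W nu].

Definition alberti_rep {R : realType} {n : nat} (X : set 'rV[R]_n)
    (mu : meas R n) (P : probability (FragT X) R) (nu : FragT X -> meas R n) : Prop :=
  radon_prob X P /\
  [/\ (forall G : FragT X, FragX X G -> radon_on X (nu G)),
      (forall G : FragT X, FragX X G -> forall A : set (BorRn R n),
          measurable A -> hausdorff1 (A `&` frag_img G) = 0%E -> nu G A = 0%E),
      (forall W, <<s wstar_open X >> W ->
          measurable ((FragX X : set (FragT X)) `&` nu @^-1` W)),
      (forall A : set (BorRn R n), measurable A ->
          (mu A = \int[P]_(G in (FragX X : set (FragT X))) nu G A)%E)
    & (forall (A : set (BorRn R n)) (a b : R), measurable A -> a <= b ->
          measurable_fun (FragX X : set (FragT X))
            ((fun G : FragT X => nu G (A `&` [set y | exists2 t, `[a, b]%classic t & G (t, y)]))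
               : FragT X -> \bar R))].

Definition in_cone {R : realType} {m : nat} (w : 'rV[R]_m) (c : R) (v : 'rV[R]_m) : Prop :=
  v != 0 /\ c * enorm v <= dotv v w.

Definition density_point {R : realType} (C : set R) (t : R) : Prop :=
  forall e : R, 0 < e -> exists2 d : R, 0 < d & forall r : R, 0 < r -> r < d ->
    (`| (lebesgue_measure : set R -> \bar R) (C `&` `[(t - r)%R, (t + r)%R]%classic)
          * ((2 * r)^-1)%:E - 1 | < e%:E)%E.

Definition frag_deriv {R : realType} {n m : nat} (G : set (R * 'rV[R]_n))
    (phi : 'rV[R]_n -> 'rV[R]_m) (t : R) (D : 'rV[R]_m) : Prop :=
  density_point (frag_dom G) t /\
  forall e : R, 0 < e -> exists2 d : R, 0 < d &
    forall t' y y', G (t, y) -> G (t', y') -> 0 < `|t' - t| < d ->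
      enorm ((t' - t)^-1 *: (phi y' - phi y) - D) < e.

Definition frag_in_dir {R : realType} {n m : nat} (phi : 'rV[R]_n -> 'rV[R]_m)
    (w : 'rV[R]_m) (c : R) (G : set (R * 'rV[R]_n)) : Prop :=
  exists N : set R, (lebesgue_measure : set R -> \bar R).-negligible N /\
    forall t, frag_dom G t -> ~ N t ->
      exists D, frag_deriv G phi t D /\ in_cone w c D.

Definition rep_in_dir {R : realType} {n m : nat} (X : set 'rV[R]_n)
    (P : probability (FragT X) R) (phi : 'rV[R]_n -> 'rV[R]_m)
    (w : 'rV[R]_m) (c : R) : Prop :=
  exists N : set (FragT X), [/\ measurable N, P N = 0%E &
    forall G : FragT X, FragX X G -> ~ N G -> frag_in_dir phi w c G].

Definition lipschitz_on {R : realType} {n m : nat} (X : set 'rV[R]_n)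
    (phi : 'rV[R]_n -> 'rV[R]_m) : Prop :=
  exists L : R, forall x y, X x -> X y -> enorm (phi x - phi y) <= L * edist x y.

Definition indep_cones {R : realType} {m k : nat} (w : 'I_k -> 'rV[R]_m)
    (c : 'I_k -> R) : Prop :=
  forall v : 'I_k -> 'rV[R]_m, (forall i, in_cone (w i) (c i) (v i)) ->
    row_free (\matrix_(i < k, j < m) v i 0 j).

Definition has_indep_alberti {R : realType} {n : nat} (X : set 'rV[R]_n)
    (mu : meas R n) (k : nat) : Prop :=
  exists (m : nat) (phi : 'rV[R]_n -> 'rV[R]_m)
         (w : 'I_k -> 'rV[R]_m) (c : 'I_k -> R)
         (P : 'I_k -> probability (FragT X) R)
         (nu : 'I_k -> FragT X -> meas R n),
    [/\ lipschitz_on X phi, (forall i, enorm (w i) = 1), indep_cones w c,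
        (forall i, alberti_rep X mu (P i) (nu i))
      & (forall i, rep_in_dir X (P i) phi (w i) (c i))].

Definition dist_to {R : realType} {n : nat} (a : 'rV[R]_n) (B : set 'rV[R]_n) : \bar R :=
  ereal_inf [set (edist a b)%:E | b in B].

Definition dR {R : realType} {n : nat} (r : R) (A B : set 'rV[R]_n) : \bar R :=
  maxe (ereal_sup [set dist_to a B | a in A `&` [set a | enorm a <= r]])
       (ereal_sup [set dist_to b A | b in B `&` [set b | enorm b <= r]]).

Definition pH_conv {R : realType} {n : nat} (A : nat -> set 'rV[R]_n)
    (L : set 'rV[R]_n) : Prop :=
  closed L /\
  forall r : R, 0 < r -> forall e : R, 0 < e ->
    exists N : nat, forall j, (N <= j)%N -> (dR r (A j) L < e%:E)%E.

Definition intrinsic_tangent {R : realType} {n : nat} (X : set 'rV[R]_n)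
    (x : 'rV[R]_n) (Y : set 'rV[R]_n) : Prop :=
  exists lam : nat -> R,
    [/\ forall j, 0 < lam j, lam @ \oo --> (0 : R) &
        pH_conv (fun j => [set (lam j)^-1 *: (a - x) | a in X]) Y].

Definition orth_compl {R : realType} {n : nat} (V : 'M[R]_n) : set 'rV[R]_n :=
  [set z | forall v : 'rV[R]_n, (v <= V)%MS -> dotv z v = 0].

(* Main.v *)
From Pilot Require Import Defs.
From HB Require Import structures.
From mathcomp Require Import all_boot all_order all_algebra.
From mathcomp Require Import all_classical all_reals all_analysis.
From mathcomp Require Import measurable_realfun.
From mathcomp Require Import ring lra.
(* Re-imported because MathComp-Analysis has its own [edist]. *)
Import Pilot.Defs.
Import HBNNSimple.
Import Order.TTheory GRing.Theory Num.Theory numFieldNormedType.Exports.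
Local Open Scope classical_set_scope.
Local Open Scope ring_scope.
Set Implicit Arguments.
Unset Strict Implicit.

(** Fix a direction (v, w) and a scale, and let E be the set of points x of X
    such that, for all small s, X has a point within eps |s| of x + s v at which
    phi is within eps |s| of phi x + s w. A fragment in the phi-direction of a
    cone is differentiable almost everywhere (Rademacher on the line), so at
    almost every parameter t, being a density point of its domain, it places
    gamma t in such an E for (v, w) = (gamma' t, (phi o gamma)' t) and all eps.
    Integrating over the Alberti representation, mu-almost every x lies, for
    every eps, in the closure of one of countably many such sets with rational
    (v, w), and compactness extracts a single (v, w) with w in the cone.

    A set is not porous at almost every point of its closure for a doubling
    measure (Vitali covering). Hence at mu-almost every x the points of X near x
    are all approximated by E, so that X near x is invariant to first order under
    the translation v, with phi changing at rate w. Such pairs (v, w) form a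
    linear space in which v = 0 forces w = 0 because phi is Lipschitz. So the
    k vectors v_i attached to the k cones are linearly independent because the
    w_i are, and every tangent of X at x is invariant under their span V; it is
    then the product of its intersection with the orthogonal complement of V
    and V. *)

(** * Rademacher's theorem for curves *)

(** Lebesgue measure is an infimum over covers by half-open intervals, so a null set has covers of
    arbitrarily small total length. *)
Lemma lebesgue_null_cover {R : realType} (A : set R) (e : R) :
  (lebesgue_measure : set R -> \bar R) A = 0%E -> 0 < e ->
  exists I : nat -> R * R,
    [/\ forall i, (I i).1 <= (I i).2,
        A `<=` \bigcup_i `](I i).1, (I i).2]%classic &
        (\sum_(0 <= i <oo) ((I i).2 - (I i).1)%:E < e%:E)%E].
Proof.
move=> A0 e0.
have : (lebesgue_measure A < e%:E)%E by rewrite A0 lte_fin.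
move/ereal_inf_lt => [_ [F [mF AF] <-] Fe].
have /choice[I HI] : forall i, exists p : R * R, p.1 <= p.2 /\ F i = `]p.1, p.2]%classic.
  move=> i; have [[a b] _ /= abF] := mF i.
  case: (leP a b) => ab; first by exists (a, b).
  (* An interval with endpoints out of order is empty; a degenerate one replaces it so that lengths
     are nonnegative. *)
  exists (a, a); split => //=; rewrite -abF set_itvoc0.
  by rewrite set_itv_ge// bnd_simp -leNgt ltW.
exists I; split.
- by move=> i; have [] := HI i.
- by apply: (subset_trans AF) => x [i _ Fx]; exists i => //; have [_ <-] := HI i.
- apply: le_lt_trans Fe; rewrite (@eq_eseriesr _ _ (fun i => wlength idfun (F i)))//.
  by move=> i _; have [h ->] := HI i; rewrite wlength_itv_bnd.
Qed.

Lemma lipschitz_continuous {R : realType} (f : R -> R) (L : R) :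
  (forall x y, `|f x - f y| <= L * `|x - y|) -> continuous f.
Proof.
move=> fL x; apply/cvgrPdist_le => /= e e0.
have L0 : 0 < `|L| + 1 by rewrite ltr_wpDl.
near=> y.
have h : `|x - y| <= e / (`|L| + 1).
  by near: y; apply: cvgr_dist_le => //; rewrite divr_gt0.
rewrite (le_trans (fL _ _))//.
rewrite (@le_trans _ _ ((`|L| + 1) * `|x - y|))//.
  by rewrite ler_wpM2r// (le_trans (ler_norm _))// lerDl.
by rewrite mulrC -ler_pdivlMr.
Unshelve. all: by end_near. Qed.

Section cumulative_lipschitz.
Context {R : realType}.
Variables (F : cumulative R R) (K : R).
Hypothesis K0 : 0 < K.
Hypothesis FK : forall x y, x <= y -> F y - F x <= K * (y - x).

Let leb : set (measurableTypeR R) -> \bar R := @lebesgue_measure R.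
Let m := lebesgue_stieltjes_measure F.

Lemma lebesgue_stieltjes_measure_itvoc (a b : R) : a <= b ->
  lebesgue_stieltjes_measure F `]a, b]%classic = (F b - F a)%:E.
Proof.
move=> ab; rewrite /lebesgue_stieltjes_measure /measure_extension.
rewrite [LHS]measurable_mu_extE/= ?wlength_itv_bnd//.
exact: is_ocitv.
Qed.

(** On each interval of a cover the Stieltjes measure is at most [K] times the length. *)
Lemma lipschitz_stieltjes_dominates (A : set (measurableTypeR R)) :
  measurable A -> leb A = 0%E -> lebesgue_stieltjes_measure F A = 0%E.
Proof.
move=> mA A0; apply/eqP; rewrite eq_le measure_ge0 andbT.
apply/lee_addgt0Pr => e e0; rewrite add0e.
have [I [I12 AI Ie]] := lebesgue_null_cover A0 (divr_gt0 e0 K0).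
apply: (@le_trans _ _ (\sum_(0 <= i <oo)
    lebesgue_stieltjes_measure F `](I i).1, (I i).2]%classic)%E).
  exact: (@measure_sigma_subadditive _ _ _ (lebesgue_stieltjes_measure F)).
apply: (@le_trans _ _ (\sum_(0 <= i <oo) (K%:E * ((I i).2 - (I i).1)%:E))%E).
  apply: lee_nneseries => i _ //.
  by rewrite lebesgue_stieltjes_measure_itvoc// -EFinM lee_fin FK.
rewrite nneseriesZl; last by move=> i _; rewrite lee_fin subr_ge0.
have -> : e%:E = (K%:E * (e / K)%:E)%E by rewrite -EFinM mulrCA divff ?mulr1// gt_eqF.
by rewrite lee_pmul2l//; exact: ltW.
Qed.

(** The Stieltjes measure of [F] is absolutely continuous, so up to a constant [F] is the indefinite
    integral of a Radon-Nikodym density, and Lebesgue differentiation applies. *)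
Lemma cumulative_lipschitz_ae_derivable :
  {ae (leb : set R -> \bar R), forall x, derivable F x 1}.
Proof.
(* Countably many bounded windows suffice, and on each of them the Stieltjes measure is finite. *)
suff H (k : nat) : {ae (leb : set R -> \bar R), forall x, - k%:R < x < k%:R -> derivable F x 1}.
  have : {ae (leb : set R -> \bar R), forall x, forall k : nat, - k%:R < x < k%:R -> derivable F x 1}.
    by apply: (@ae_foralln _ _ _ (@lebesgue_measure R)).
  apply: filterS; first exact: (ae_filter_ringOfSetsType leb).
  move=> x /(_ (Num.bound `|x|)); apply.
  by rewrite -ltr_norml archi_boundP.
pose D : set (measurableTypeR R) := `](- k%:R : R), k%:R]%classic.
have mD : measurable D by exact: measurable_itv.
have kk : - k%:R <= k%:R :> R by rewrite ge0_cp.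
have Doo : (m D < +oo)%E by rewrite /m lebesgue_stieltjes_measure_itvoc// ltry.
pose nu : {finite_measure set (measurableTypeR R) -> \bar R} := mfrestr mD Doo.
have nuleb : nu `<< (leb : {sigma_finite_measure set (measurableTypeR R) -> \bar R}).
  apply/null_content_dominatesP => A mA A0.
  rewrite /nu/= /mfrestr /mrestr.
  apply: (@subset_measure0 _ _ _ m _ A) => //; first exact: measurableI.
  exact: lipschitz_stieltjes_dominates.
set h := Radon_Nikodym_SigmaFinite.f nu leb.
have ih : leb.-integrable setT h by exact: Radon_Nikodym_SigmaFinite.f_integrable.
pose g := fine \o h.
have gE : EFin \o g = h.
  by apply/funext => x; rewrite /= fineK//; exact: Radon_Nikodym_SigmaFinite.f_fin_num.
have ig : leb.-integrable setT (EFin \o g) by rewrite gE.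
have FE y : - k%:R <= y -> y <= k%:R ->
    \int[leb]_(t in [set` Interval (BRight (- k%:R)) (BRight y)]) g t = F y - F (- k%:R).
  move=> ky yk.
  rewrite /Rintegral (eq_integral h); last by move=> t _; rewrite -gE.
  rewrite -Radon_Nikodym_SigmaFinite.f_integral//.
  rewrite /nu/= /mfrestr /mrestr setIidl.
    by rewrite -/(`]_, _]) lebesgue_stieltjes_measure_itvoc.
  apply: subset_itvl; rewrite bnd_simp//.
have lg : locally_integrable setT g.
  by apply: open_integrable_locally => //; exact: openT.
have iy y : leb.-integrable [set` Interval (BRight (- k%:R)) (BRight y)] (EFin \o g).
  exact: integrableS ig.
have := FTC1 iy lg.
apply: filterS; first exact: (ae_filter_ringOfSetsType leb).
move=> x + /andP[kx xk] => /(_ _)[|]; first by rewrite /= lte_fin.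
move=> + _.
pose G (y : R) : R := F y - F (- k%:R).
have nG : \forall y \near x, \int[leb]_(t in [set` Interval (BRight (- k%:R)) (BRight y)]) g t = G y.
  have : \forall y \near x, y \in `](- k%:R), k%:R[ by apply: near_in_itvoo; rewrite in_itv/= kx.
  apply: filterS => y; rewrite in_itv/= => /andP[? ?]; exact: FE (ltW _) (ltW _).
move=> dI.
have dG : derivable G x 1.
  apply: near_eq_derivable dI; exact: nG.
have -> : (F : R -> R) = G \+ cst (F (- k%:R)).
  by apply/funext => y; rewrite /= /G subrK.
exact: derivableD.
Qed.

End cumulative_lipschitz.

(** Adding the linear function [K * x] makes [f] nondecreasing, hence the distribution function of a
    measure, without affecting differentiability. *)
Lemma lipschitz_ae_derivable {R : realType} (f : R -> R) (L : R) :
  (forall x y, `|f x - f y| <= L * `|x - y|) ->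
  {ae (lebesgue_measure : set R -> \bar R), forall x, derivable f x 1}.
Proof.
move=> fL0; pose K := `|L| + 1.
have K0 : 0 < K by rewrite ltr_wpDl.
have fL x y : `|f x - f y| <= K * `|x - y|.
  by rewrite (le_trans (fL0 _ _))// ler_wpM2r// (le_trans (ler_norm _))// lerDl.
pose F x := f x + K * x.
have nd : {homo F : x y / x <= y}.
  move=> x y xy; rewrite /F.
  have := fL x y; rewrite (ler0_norm (_ : x - y <= 0)) ?subr_le0//.
  by rewrite ler_norml => /andP[_]; lra.
have FK x y : `|F x - F y| <= (2 * K) * `|x - y|.
  rewrite /F (_ : _ - _ = (f x - f y) + K * (x - y)); last by ring.
  rewrite (le_trans (ler_normD _ _))// normrM (gtr0_norm K0).
  by have := fL x y; lra.
have rc : right_continuous F by apply: right_continuousW; exact: lipschitz_continuous FK.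
pose Fc : cumulative R R := HB.pack F (isCumulative.Build R _ R F nd rc).
have FK' x y : x <= y -> Fc y - Fc x <= (2 * K) * (y - x).
  move=> xy; rewrite -[y - x]ger0_norm ?subr_ge0//.
  exact: le_trans (ler_norm _) (FK _ _).
have K20 : 0 < 2 * K by rewrite mulr_gt0.
have := cumulative_lipschitz_ae_derivable K20 FK'.
apply: filterS; first exact: (ae_filter_ringOfSetsType lebesgue_measure).
move=> x dF.
have -> : f = Fc \- ( *%R K).
  by apply/funext => y; rewrite /= /F addrK.
exact: derivableB.
Qed.

Lemma rV_norm_leP {R : realType} {n : nat} (v : 'rV[R]_n) (r : R) : 0 <= r ->
  reflect (forall j, `|v 0 j| <= r) (`|v| <= r).
Proof.
move=> r0; rewrite [`|v|]mx_normrE; apply: (iffP (bigmax_leP _ _ _ _)).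
  by move=> [_ h] j; exact: (h (0, j)).
by move=> h; split => // -[i j] _ /=; rewrite ord1.
Qed.

Lemma rV_coord_le_norm {R : realType} {n : nat} (v : 'rV[R]_n) j : `|v 0 j| <= `|v|.
Proof. by move: j; apply/rV_norm_leP. Qed.

Lemma enorm_ge0 {R : realType} {n : nat} (v : 'rV[R]_n) : 0 <= enorm v.
Proof. exact: sqrtr_ge0. Qed.

Lemma norm_le_enorm {R : realType} {n : nat} (v : 'rV[R]_n) : `|v| <= enorm v.
Proof.
apply/rV_norm_leP => [|j]; first exact: enorm_ge0.
rewrite -sqrtr_sqr ler_wsqrtr// /dotv (bigD1 j)//= -expr2 lerDl.
by apply: sumr_ge0 => i _; rewrite -expr2 sqr_ge0.
Qed.

Lemma enorm_le_norm {R : realType} {n : nat} (v : 'rV[R]_n) : enorm v <= n%:R * `|v|.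
Proof.
rewrite -[leRHS]ger0_norm ?mulr_ge0// -sqrtr_sqr ler_wsqrtr//.
apply: (@le_trans _ _ (\sum_(i < n) `|v| ^+ 2)).
  apply: ler_sum => i _; rewrite -expr2 -real_normK ?num_real//.
  by rewrite lerXn2r ?nnegrE// rV_coord_le_norm.
rewrite sumr_const card_ord exprMn -[leLHS]mulr_natl ler_wpM2r ?sqr_ge0//.
by rewrite -natrX ler_nat; case: n {v} => // n; rewrite expnS leq_pmulr// expn_gt0.
Qed.

(** McShane's formula: the supremum over [c] in [C] of the downward cones [f c - |L| * |t - c|]. The
    absolute value covers a negative [L]. *)
Lemma lipschitz_extension {R : realType} (C : set R) (f : R -> R) (L : R) :
  (forall s t, C s -> C t -> `|f s - f t| <= L * `|s - t|) ->
  exists g : R -> R, (forall x y, `|g x - g y| <= `|L| * `|x - y|) /\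
    forall t, C t -> g t = f t.
Proof.
move=> fL0.
have fL s t : C s -> C t -> `|f s - f t| <= `|L| * `|s - t|.
  by move=> Cs Ct; rewrite (le_trans (fL0 _ _ Cs Ct))// ler_wpM2r// ler_norm.
have [[c0 Cc0]|C0] := pselect (C !=set0); last first.
  exists (cst 0); split; first by move=> x y; rewrite subrr normr0 mulr_ge0.
  by move=> t Ct; exfalso; apply: C0; exists t.
pose S (t : R) : set R := [set f c - `|L| * `|t - c| | c in C].
have S0 t : S t !=set0 by exists (f c0 - `|L| * `|t - c0|), c0.
have tri (x y c : R) : `|L| * `|x - c| <= `|L| * `|x - y| + `|L| * `|y - c|.
  rewrite -mulrDr ler_wpM2l// (le_trans _ (ler_normD _ _))//.
  by rewrite addrA subrK.
have Sub t : has_ubound (S t).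
  exists (f c0 + `|L| * `|t - c0|) => _ [c Cc <-].
  have := fL _ _ Cc Cc0; rewrite ler_norml => /andP[_ h].
  have := tri c t c0; rewrite (distrC c t); lra.
exists (fun t => sup (S t)); split.
  have H x y : sup (S x) <= sup (S y) + `|L| * `|x - y|.
    apply: ge_sup => // _ [c Cc <-].
    have : f c - `|L| * `|y - c| <= sup (S y) by apply: ub_le_sup => //; exists c.
    have := tri y x c; rewrite (distrC y x); lra.
  move=> x y; rewrite ler_norml; apply/andP; split; last by rewrite lerBlDl.
  by have := H y x; rewrite (distrC y x); lra.
move=> t Ct; apply/le_anti/andP; split.
  apply: ge_sup => // _ [c Cc <-].
  have := fL _ _ Cc Ct; rewrite ler_norml => /andP[_ h].
  by rewrite (distrC t c); lra.
have -> : f t = f t - `|L| * `|t - t| by rewrite subrr normr0 mulr0 subr0.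
by apply: ub_le_sup => //; exists t.
Qed.

(** The derivative of a Lipschitz extension serves as [D]. The first-order expansion, unlike a
    difference quotient, needs no case distinction at isolated points of [C]. *)
Lemma lipschitz_ae_derivative {R : realType} (C : set R) (f : R -> R) (L : R) :
  (forall s t, C s -> C t -> `|f s - f t| <= L * `|s - t|) ->
  exists N : set R, (lebesgue_measure : set R -> \bar R).-negligible N /\
    forall t, C t -> ~ N t -> exists D : R, forall e, 0 < e ->
      \forall t' \near t, C t' -> `|f t' - f t - (t' - t) * D| <= e * `|t' - t|.
Proof.
move=> /lipschitz_extension[g [gL gf]].
have dg := lipschitz_ae_derivable gL.
exists (~` [set t | derivable g t 1]); split.
  by move: dg; rewrite /almost_everywhere.
move=> t Ct /contrapT /= dt.
have /is_derive1_caratheodory[h [hE ch ht]] : is_derive t 1 g ('D_1 g t).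
  exact: DeriveDef.
exists ('D_1 g t) => e e0.
move/cvgrPdist_le : ch => /(_ e e0); apply: filterS => t' ht' Ct'.
rewrite -!gf// hE -ht (mulrC (t' - t)) -mulrBl normrM ler_wpM2r//.
by rewrite distrC.
Qed.

Lemma rV_lipschitz_ae_derivative {R : realType} {n : nat} (C : set R)
    (f : R -> 'rV[R]_n) (L : R) :
  (forall s t, C s -> C t -> `|f s - f t| <= L * `|s - t|) ->
  exists N : set R, (lebesgue_measure : set R -> \bar R).-negligible N /\
    forall t, C t -> ~ N t -> exists D : 'rV[R]_n, forall e, 0 < e ->
      \forall t' \near t, C t' -> `|f t' - f t - (t' - t) *: D| <= e * `|t' - t|.
Proof.
move=> fL.
have H (j : 'I_n) : exists N : set R,
    (lebesgue_measure : set R -> \bar R).-negligible N /\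
    forall t, C t -> ~ N t -> exists D : R, forall e, 0 < e ->
      \forall t' \near t, C t' -> `|f t' 0 j - f t 0 j - (t' - t) * D| <= e * `|t' - t|.
  apply: (@lipschitz_ae_derivative _ C (fun t => f t 0 j) L) => s t Cs Ct.
  rewrite (le_trans _ (fL _ _ Cs Ct))//.
  by have := rV_coord_le_norm (f s - f t) j; rewrite !mxE.
move/choice : H => [N HN].
exists (\bigcup_(j in [set: 'I_n]) N j); split.
  rewrite bigcup_mkcond.
  (* The finitely many coordinates are embedded in a sequence of null sets, empty beyond index
     [n]. *)
  have := @negligible_bigcup _ _ _ (@lebesgue_measure R)
    (fun i => if insub i is Some j then N j else set0).
  move=> h; apply: (@negligibleS _ _ _ lebesgue_measure _ _ _ (h _)).
    move=> x [j _]; rewrite mem_setT => Njx; exists (nat_of_ord j) => //=.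
    by rewrite valK.
  move=> i; case: insubP => [j _ _|_]; first by have [] := HN j.
  exact: negligible_set0.
move=> t Ct Nt.
have /choice[D HD] : forall j : 'I_n, exists D : R, forall e, 0 < e ->
   \forall t' \near t, C t' -> `|f t' 0 j - f t 0 j - (t' - t) * D| <= e * `|t' - t|.
  by move=> j; have [_ /(_ t Ct)] := HN j; apply => Njt; apply: Nt; exists j.
exists (\row_j D j) => e e0.
have := @filter_forall _ _ (fun (j : 'I_n) t' => C t' ->
    `|f t' 0 j - f t 0 j - (t' - t) * D j| <= e * `|t' - t|) (nbhs t) _
  (fun j => HD j e e0).
move=> /(_ _); apply: filterS => t' h Ct'.
by apply/rV_norm_leP => [|j]; [rewrite mulr_ge0// ltW|rewrite !mxE; exact: h].
Qed.

(** The images of the intervals of a short cover have diameters at most [L] times the lengths. *)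
Lemma hausdorff1_lipschitz_null {R : realType} {n : nat} (C N : set R)
    (g : R -> 'rV[R]_n) (L : R) (A : set 'rV[R]_n) : 0 < L ->
  (forall s t, C s -> C t -> edist (g s) (g t) <= L * `|s - t|) ->
  (lebesgue_measure : set R -> \bar R).-negligible N ->
  A `<=` g @` (C `&` N) -> hausdorff1 A = 0%E.
Proof.
move=> L0 gL [N' [mN' N'0 NN']] AgN.
have ediam_ge0 (F : set 'rV[R]_n) : (0 <= ediam F)%E.
  by apply: ereal_sup_ubound; right.
have delta_ge0 d : (0 <= hausdorff1_delta d A)%E.
  by rewrite /hausdorff1_delta; apply: le_ereal_inf_tmp => _ [F _ <-]; apply: nneseries_ge0 => i _ _; exact: ediam_ge0.
apply/eqP; rewrite eq_le; apply/andP; split; last first.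
  apply: (le_trans (delta_ge0 1)); rewrite /hausdorff1.
  by apply: ereal_sup_ubound; exists 1 => /=.
apply: ge_ereal_sup => _ [d /= d0 <-].
apply/lee_addgt0Pr => e e0; rewrite add0e.
(* With this total length the diameters sum to at most [Num.min d e]: below [e] in total, and each
   one below [d]. *)
have m0 : 0 < Num.min d e / L by rewrite divr_gt0// lt_min d0.
have [I [I12 NI Ie]] := lebesgue_null_cover N'0 m0.
pose F i := g @` (C `&` `](I i).1, (I i).2]%classic).
have dF i : (ediam (F i) <= L%:E * ((I i).2 - (I i).1)%:E)%E.
  apply: ge_ereal_sup => x [|->]; last by rewrite -EFinM lee_fin mulr_ge0 ?subr_ge0// ltW.
  move=> [[p q] [/= [s [Cs Is] sp] [t [Ct It] tq]] <-] /=; rewrite -sp -tq.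
  rewrite -EFinM lee_fin (le_trans (gL _ _ Cs Ct))// ler_wpM2l ?(ltW L0)//.
  move: Is It; rewrite /= !in_itv/= => /andP[? ?] /andP[? ?].
  by rewrite ler_norml; apply/andP; split; lra.
have sumI : (\sum_(0 <= i <oo) (L%:E * ((I i).2 - (I i).1)%:E) <= (Num.min d e)%:E)%E.
  rewrite nneseriesZl; last by move=> i _; rewrite lee_fin subr_ge0.
  have -> : (Num.min d e)%:E = (L%:E * (Num.min d e / L)%:E)%E.
    by rewrite -EFinM mulrCA divff ?mulr1// gt_eqF.
  by rewrite lee_pmul2l//; exact: ltW.
have LI0 i : (0 <= L%:E * ((I i).2 - (I i).1)%:E)%E.
  by rewrite -EFinM lee_fin mulr_ge0 ?subr_ge0// ltW.
apply: ge_ereal_inf; exists (\sum_(0 <= i <oo) ediam (F i))%E; last first.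
  apply: (@le_trans _ _ (Num.min d e)%:E); last by rewrite lee_fin ge_min lexx orbT.
  by apply: le_trans sumI; apply: lee_nneseries.
exists F => //; split.
  move=> _ /AgN[t [Ct Nt] <-]; have [i _ It] := NI _ (NN' _ Nt).
  by exists i => //; exists t.
move=> i; apply: (le_trans (dF i)).
apply: (@le_trans _ _ (Num.min d e)%:E); last by rewrite lee_fin ge_min lexx.
apply: le_trans sumI.
have := @nneseries_lim_ge _ _ xpredT 0%N i.+1 (fun i _ _ => LI0 i).
apply: le_trans; rewrite big_nat_recr//= leeDr//.
by apply: sume_ge0.
Qed.

(** * Vitali covering and porosity for doubling measures *)

Definition balls_meet {R : realType} {T : normedModType R} (p q : T * R) : Prop :=
  ball p.1 p.2 `&` ball q.1 q.2 !=set0.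

(* One application of Zorn's lemma to the disjoint subfamilies [D] such that a
   ball of [V] meeting some ball of [D] meets one of comparable radius. *)
Lemma vitali_disjoint_subfamily {R : realType} {T : normedModType R}
    (V : set (T * R)) (m : R) :
  (forall p, V p -> 0 < p.2 <= m) ->
  exists D : set (T * R), [/\ D `<=` V,
    forall p q, D p -> D q -> balls_meet p q -> p = q &
    forall p, V p -> exists q, [/\ D q, balls_meet p q & p.2 <= 2 * q.2]].
Proof.
move=> Vm.
have meetC (p q : T * R) : balls_meet p q -> balls_meet q p.
  by rewrite /balls_meet setIC.
have meetxx p : V p -> balls_meet p p.
  by move=> /Vm/andP[p0 _]; exists p.1; split; exact: ballxx.
pose P (D : set (T * R)) := [/\ D `<=` V,
    forall p q, D p -> D q -> balls_meet p q -> p = q &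
    forall p, V p -> (exists2 q, D q & balls_meet p q) ->
      exists q, [/\ D q, balls_meet p q & p.2 <= 2 * q.2]].
have [|A [[AV Adis Asize] Amax]] := @Zorn_bigcup _ P.
  move=> F FP Ftot; split.
  - by move=> p [B FB Bp]; have [+ _ _] := FP _ FB; apply.
  - move=> p q [B FB Bp] [C FC Cq].
    have [BC|CB] := Ftot _ _ FB FC.
      by have [_ + _] := FP _ FC; apply => //; exact: BC.
    by have [_ + _] := FP _ FB; apply => //; exact: CB.
  - move=> p Vp [q [B FB Bq] pq].
    have [_ _ /(_ p Vp)[|q' [Bq' pq' h]]] := FP _ FB; first by exists q.
    by exists q'; split => //; exists B.
exists A; split => // p Vp.
have [/Asize|nmeet] := pselect (exists2 q, A q & balls_meet p q); first exact.
exfalso.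
(* If some ball misses the maximal family, one whose radius exceeds half the supremum of such radii
   can be added: every ball missing the old family has at most twice its radius. This contradicts
   maximality. *)
pose S : set R := [set p.2 | p in V `&` [set p | ~ exists2 q, A q & balls_meet p q]].
have Sp : S p.2 by exists p.
have hS : has_sup S.
  split; first by exists p.2.
  by exists m => _ [q [/Vm/andP[_ qm] _] <-].
have p0 : 0 < p.2 by have /andP[] := Vm _ Vp.
have s0 : 0 < sup S by apply: (lt_le_trans p0); exact: (ub_le_sup hS.2).
have [_ [p' [Vp' p'A] <-] p's] : exists2 x, S x & sup S - sup S / 2 < x.
  by apply: sup_adherent => //; rewrite divr_gt0.
pose B := A `|` [set p'].
apply: (Amax B).
  split; first by left.
  move/(_ p' (or_intror erefl)) => Ap'; apply: p'A; exists p' => //.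
  exact: meetxx.
split.
- by move=> q [/AV|->].
- move=> q q' [Aq|->] [Aq'|->] //.
  + exact: Adis.
  + by move=> /meetC h; exfalso; apply: p'A; exists q.
  + by move=> h; exfalso; apply: p'A; exists q'.
- move=> q Vq [q' Bq' qq'].
  have [/(Asize _ Vq)[q2 [Aq2 h1 h2]]|nq] := pselect (exists2 q', A q' & balls_meet q q').
    by exists q2; split => //; left.
  case: Bq' => [Aq'|q'p']; first by exfalso; apply: nq; exists q'.
  exists p'; split; [by right|by rewrite -q'p'|].
  have : q.2 <= sup S by apply: (ub_le_sup hS.2); exists q.
  lra.
Qed.

Lemma ball_norm_lt {R : realType} {n : nat} (x y : 'rV[R]_n) (r : R) :
  ball x r y = (`|x - y| < r) :> Prop.
Proof. by rewrite -ball_normE. Qed.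

Lemma rV_rat_approx {R : realType} {n : nat} (v : 'rV[R]_n) (e : R) : 0 < e ->
  exists q : 'rV[rat]_n, `|v - map_mx ratr q| < e.
Proof.
move=> e0.
have /choice[q Hq] : forall j : 'I_n, exists q : rat, `|v 0 j - ratr q| <= e / 2.
  move=> j; have [|q] := @rat_in_itvoo R (v 0 j - e / 2) (v 0 j + e / 2); first lra.
  rewrite in_itv/= => /andP[h1 h2]; exists q.
  by rewrite ler_norml; apply/andP; split; lra.
exists (\row_j q j); apply: (@le_lt_trans _ _ (e / 2)); last lra.
apply/rV_norm_leP => [|j]; first lra.
by rewrite !mxE; exact: Hq.
Qed.

(** Each ball contains a rational point, and distinct balls of the family cannot share one. *)
Lemma disjoint_balls_enum {R : realType} {n : nat} (D : set ('rV[R]_n * R)) :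
  (forall p, D p -> 0 < p.2) ->
  (forall p q, D p -> D q -> balls_meet p q -> p = q) ->
  exists f : 'rV[R]_n * R -> nat, forall p q, D p -> D q -> f p = f q -> p = q.
Proof.
move=> D0 Ddis.
have /choice[g Hg] : forall p : 'rV[R]_n * R, exists q : 'rV[rat]_n,
    D p -> ball p.1 p.2 (map_mx ratr q).
  move=> p; have [Dp|] := pselect (D p); last by exists 0.
  by have [q Hq] := rV_rat_approx p.1 (D0 _ Dp); exists q; rewrite ball_norm_lt.
exists (fun p => pickle (g p)) => p q Dp Dq /(pcan_inj pickleK) gpq.
apply: Ddis => //; exists (map_mx ratr (g p)); split; first exact: Hg.
by rewrite gpq; exact: Hg.
Qed.

Lemma open_measurable_BorRn {R : realType} {n : nat} (U : set 'rV[R]_n) :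
  open U -> measurable (U : set (BorRn R n)).
Proof. by move=> oU; exact: sub_sigma_algebra. Qed.

Lemma closed_measurable_BorRn {R : realType} {n : nat} (F : set 'rV[R]_n) :
  closed F -> measurable (F : set (BorRn R n)).
Proof.
move=> cF; rewrite -[F]setCK; apply: measurableC.
by apply: open_measurable_BorRn; exact: closed_openC.
Qed.

Lemma ball_measurable_BorRn {R : realType} {n : nat} (x : 'rV[R]_n) (r : R) :
  measurable (ball x r : set (BorRn R n)).
Proof. by apply: open_measurable_BorRn; exact: ball_open. Qed.

Lemma dotv_continuous {R : realType} {n : nat} (w : 'rV[R]_n) :
  continuous (fun v : 'rV[R]_n => dotv v w).
Proof.
apply: continuous_big; first exact: add_continuous.
by move=> i _ v; apply: continuousM; [exact: coord_continuous|exact: cst_continuous].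
Qed.

Lemma enorm_continuous {R : realType} {n : nat} : continuous (@enorm R n).
Proof.
have H : continuous (fun v : 'rV[R]_n => dotv v v).
  apply: continuous_big; first exact: add_continuous.
  by move=> i _ u; apply: continuousM; exact: coord_continuous.
by move=> v; apply: continuous_comp; [exact: H|exact: sqrt_continuous].
Qed.

Lemma eball_measurable_BorRn {R : realType} {n : nat} (x : 'rV[R]_n) (r : R) :
  measurable (eball x r : set (BorRn R n)).
Proof.
apply: open_measurable_BorRn.
have -> : eball x r = (fun y => enorm (x - y)) @^-1` [set z | z < r] by [].
apply: open_comp; last exact: open_lt.
move=> y _; apply: continuous_comp; last exact: enorm_continuous.
by apply: continuousB => //; exact: cst_continuous.
Qed.

Lemma eball_subset_ball {R : realType} {n : nat} (x : 'rV[R]_n) (r : R) :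
  eball x r `<=` ball x r.
Proof. by move=> y; rewrite ball_norm_lt; apply: le_lt_trans; exact: norm_le_enorm. Qed.

Lemma ball_subset_eball {R : realType} {n : nat} (x : 'rV[R]_n) (r s : R) :
  0 < r -> n%:R * r < s -> ball x r `<=` eball x s.
Proof.
move=> r0 rs y; rewrite ball_norm_lt => h; rewrite /eball /=.
apply: le_lt_trans rs; apply: (le_trans (enorm_le_norm _)).
by rewrite ler_wpM2l// ltW.
Qed.

Section doubling.
Context {R : realType} {n : nat} (X : set 'rV[R]_n) (mu : meas R n).
Hypothesis dmu : doubling_on X mu.

(** Transfers doubling from Euclidean balls to sup-norm balls, and from factor 2 to any [l]: the two
    norms differ by a factor at most [n], so enough iterations of the doubling inequality absorb
    both [n] and [l]. *)
Lemma doubling_ball (l : R) : 0 < l -> exists2 C : R, 0 <= C &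
  forall x r, X x -> 0 < r -> (mu (ball x (l * r)) <= C%:E * mu (ball x r))%E.
Proof.
move=> l0; have [_ _ [C0 HC0]] := dmu.
have [C C_ge0 HC] : exists2 C : R, 0 <= C & forall x r, X x -> 0 < r ->
    (mu (eball x (2 * r)) <= C%:E * mu (eball x r))%E.
  exists `|C0| => // x r Xx r0; apply: (le_trans (HC0 _ _ Xx r0)).
  by rewrite lee_wpmul2r// lee_fin ler_norm.
have HCp p x r : X x -> 0 < r ->
    (mu (eball x (2 ^+ p * r)) <= (C ^+ p)%:E * mu (eball x r))%E.
  move=> Xx r0; elim: p => [|p IH]; first by rewrite !expr0 mul1r mul1e.
  rewrite !exprS -mulrA; apply: (le_trans (HC _ _ Xx _)).
    by rewrite mulr_gt0// exprn_gt0.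
  by rewrite EFinM -muleA lee_wpmul2l// lee_fin.
have [p Hp] : exists p : nat, n%:R * l < 2 ^+ p.
  exists (Num.bound (n%:R * l : R)).
  apply: (lt_trans (archi_boundP _)); first by rewrite mulr_ge0// ltW.
  by rewrite -natrX ltr_nat; exact: ltn_expl.
exists (C ^+ p); first by rewrite exprn_ge0.
move=> x r Xx r0.
apply: (@le_trans _ _ (mu (eball x (2 ^+ p * r)))).
  apply: le_measure; rewrite ?inE.
  - exact: ball_measurable_BorRn.
  - exact: eball_measurable_BorRn.
  - by apply: ball_subset_eball; [rewrite mulr_gt0|rewrite mulrA ltr_pM2r].
apply: (le_trans (HCp p x r Xx r0)).
rewrite lee_wpmul2l ?lee_fin ?exprn_ge0//.
apply: le_measure; rewrite ?inE.
- exact: eball_measurable_BorRn.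
- exact: ball_measurable_BorRn.
- exact: eball_subset_ball.
Qed.

Lemma doubling_ball_lty (x : 'rV[R]_n) (r : R) : X x -> 0 < r -> (mu (ball x r) < +oo)%E.
Proof.
move=> Xx r0; have [_ /(_ x (n%:R * r + 1) Xx) H _] := dmu.
have [|_] := H; first by rewrite ltr_wpDl// mulr_ge0// ltW.
apply: le_lt_trans; apply: le_measure; rewrite ?inE.
- exact: ball_measurable_BorRn.
- exact: eball_measurable_BorRn.
- by apply: ball_subset_eball => //; rewrite ltrDl.
Qed.

(** The witness that [E] is porous relative to [X] at the point [x] and scale [r]. *)
Definition hole (E : set 'rV[R]_n) (eta : R) (x : 'rV[R]_n) (r : R) (y : 'rV[R]_n) :=
  [/\ X y, `|x - y| <= r & forall z, E z -> eta * r <= `|z - y|].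

(** Vitali's covering yields disjoint balls whose triples cover [S]. By doubling each triple is
    controlled by the hole inside its ball, and the holes are disjoint, contained in [U] and
    disjoint from [H]. *)
Lemma porous_cover (E U H : set 'rV[R]_n) (S : set 'rV[R]_n) (eta d : R) (C : R) :
  0 < eta <= 1 -> 0 < d ->
  (forall x r, X x -> 0 < r ->
    (mu (ball x (7 / eta * r)) <= C%:E * mu (ball x r))%E) -> 0 <= C ->
  measurable (U : set (BorRn R n)) -> measurable (H : set (BorRn R n)) ->
  H `<=` closure E -> 
  (forall x, S x -> ball x (2 * d) `<=` U) ->
  (forall x, S x -> exists r, 0 < r <= d /\ exists y, hole E eta x r y) ->
  exists O : set 'rV[R]_n, [/\ open O, S `<=` O &
    (mu O <= C%:E * mu (U `\` H))%E].
Proof.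
move=> /andP[eta0 eta1] d0 HC C0 mU mH HE SU Sh.
(* The radius is twice the scale of the hole, so that the whole hole, and not only its centre, fits
   in the ball. *)
pose V : set ('rV[R]_n * R) :=
  [set p | S p.1 /\ 0 < p.2 <= 2 * d /\ exists y, hole E eta p.1 (p.2 / 2) y].
have Vm p : V p -> 0 < p.2 <= 2 * d by case=> _ [].
have [D [DV Ddis Dcov]] := vitali_disjoint_subfamily Vm.
have D0 p : D p -> 0 < p.2 by move=> /DV/Vm/andP[].
have [f finj] := disjoint_balls_enum D0 Ddis.
have /choice[c Hc] : forall p : 'rV[R]_n * R, exists y,
    D p -> hole E eta p.1 (p.2 / 2) y.
  move=> p; have [/DV[_ [_ [y hy]]]|] := pselect (D p); first by exists y.
  by exists 0.
(* At most one ball has index [i], so each of these unions is a single ball or empty. *)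
pose A i : set 'rV[R]_n := \bigcup_(p in [set p | D p /\ f p = i]) ball p.1 (3 * p.2).
pose B i : set 'rV[R]_n := \bigcup_(p in [set p | D p /\ f p = i]) ball (c p) (eta * (p.2 / 2)).
have oA i : open (A i) by apply: bigcup_open => p _; exact: ball_open.
have oB i : open (B i) by apply: bigcup_open => p _; exact: ball_open.
have Bsub p : D p -> ball (c p) (eta * (p.2 / 2)) `<=` ball p.1 p.2.
  move=> Dp z; rewrite !ball_norm_lt => h.
  have [_ h2 _] := Hc _ Dp; have p0 := D0 _ Dp.
  have h3 : eta * (p.2 / 2) <= p.2 / 2 by rewrite ler_piMl// ltW// divr_gt0.
  rewrite (_ : p.1 - z = (p.1 - c p) + (c p - z)); last by rewrite addrA subrK.
  apply: (le_lt_trans (ler_normD _ _)); lra.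
have AB i : (mu (A i) <= C%:E * mu (B i))%E.
  have [[p [Dp fp]]|np] := pselect (exists p, D p /\ f p = i); last first.
    have -> : A i = set0 by apply/seteqP; split => // z [p Hp _]; apply: np; exists p.
    by rewrite measure0 mule_ge0// lee_fin.
  have uniqp : [set p | D p /\ f p = i] = [set p].
    apply/seteqP; split => [q [Dq fq]|q ->//].
    by apply: finj => //; rewrite fq fp.
  rewrite /A /B uniqp !bigcup_set1.
  (* The hole's centre is within [p.2 / 2] of [p.1], so the tripled ball lies within [7 * (p.2 / 2)]
     of it, that is [7 / eta] times the hole's radius. *)
  have [Xc h _] := Hc _ Dp; have p0 := D0 _ Dp.
  apply: le_trans (HC _ _ Xc _); last by rewrite mulr_gt0// divr_gt0.
  apply: le_measure; rewrite ?inE; [exact: ball_measurable_BorRn..|].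
  move=> z; rewrite !ball_norm_lt => hz.
  rewrite (_ : 7 / eta * (eta * (p.2 / 2)) = 7 * (p.2 / 2)); last first.
    by field; rewrite gt_eqF.
  rewrite (_ : c p - z = (c p - p.1) + (p.1 - z)); last by rewrite addrA subrK.
  apply: (le_lt_trans (ler_normD _ _)); rewrite distrC; lra.
exists (\bigcup_i A i); split.
- by apply: bigcup_open.
- move=> x Sx; have [r [/andP[r0 rd] [y hy]]] := Sh _ Sx.
  have Vx : V (x, 2 * r).
    split => //=; split; first by apply/andP; split; lra.
    by exists y; rewrite (_ : 2 * r / 2 = r)//; lra.
  have [q [Dq [z [/= xz qz]] h]] := Dcov _ Vx.
  exists (f q) => //; exists q => //.
  move: xz qz h; rewrite !ball_norm_lt /= => xz qz h.
  rewrite (_ : q.1 - x = (q.1 - z) + (z - x)); last by rewrite addrA subrK.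
  apply: (le_lt_trans (ler_normD _ _)); rewrite (distrC z); lra.
- apply: (@le_trans _ _ (\sum_(0 <= i <oo) mu (A i))%E).
    apply: (@measure_sigma_subadditive _ _ _ mu) => //.
      by move=> i; exact: open_measurable_BorRn.
    by apply: open_measurable_BorRn; apply: bigcup_open.
  apply: (@le_trans _ _ (\sum_(0 <= i <oo) (C%:E * mu (B i)))%E).
    by apply: lee_nneseries => i _ //; exact: AB.
  rewrite nneseriesZl//.
  rewrite lee_wpmul2l ?lee_fin//.
  have mB i : measurable (B i : set (BorRn R n)) by exact: open_measurable_BorRn.
  have tB : trivIset setT B.
    apply/trivIsetP => i j _ _ ij; apply/seteqP; split => // z [].
    move=> [p [Dp fp] zp] [q [Dq fq] zq].
    move/eqP: ij; apply; rewrite -fp -fq; congr f; apply: Ddis => //.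
    by exists z; split; exact: Bsub.
  rewrite (_ : (\sum_(0 <= i <oo) mu (B i))%E = mu (\bigcup_i B i)); last first.
    by rewrite measure_bigcup//; apply: eq_eseriesl => i; rewrite in_setT.
  apply: le_measure; rewrite ?inE.
  + exact: bigcup_measurable.
  + exact: measurableD.
  + move=> z [i _ [p [Dp _] zp]]; split.
      have [Sp [/andP[_ pd] _]] := DV _ Dp.
      apply: (SU _ Sp); move: (Bsub _ Dp _ zp).
      by rewrite !ball_norm_lt => h; exact: lt_le_trans pd.
    (* A point of [H] is a limit of points of [E], so the open hole around it would meet [E]. *)
    move=> /HE /(_ (ball (c p) (eta * (p.2 / 2)))) [|w [Ew]].
      by apply: open_nbhs_nbhs; split => //; exact: ball_open.
    rewrite ball_norm_lt distrC ltNge => /negP; apply.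
    by have [_ _] := Hc _ Dp; apply.
Qed.

End doubling.

Definition nonporous_at {R : realType} {n : nat} (X E : set 'rV[R]_n) (x : 'rV[R]_n) :=
  forall eta, 0 < eta -> exists2 rho, 0 < rho &
    forall r, 0 < r < rho -> forall y, X y -> `|x - y| <= r ->
      exists2 z, E z & `|z - y| < eta * r.

Section porosity.
Context {R : realType} {n : nat} (X : set 'rV[R]_n) (mu : meas R n).
Hypothesis dmu : doubling_on X mu.

(** [S] lies in the closed bounded set [H], whose shrinking neighbourhoods [U i] satisfy mu (U i \
    H) -> 0. The porous covering bounds the measure of open sets containing [S] by a fixed multiple
    of these quantities. *)
Lemma negligible_porous_bounded (E : set 'rV[R]_n) (x0 : 'rV[R]_n) (eta : R) (k : nat) :
  X x0 -> 0 < eta <= 1 ->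
  mu.-negligible ([set x | [/\ X x, closure E x, `|x0 - x| <= k%:R &
    forall rho, 0 < rho -> exists r, 0 < r < rho /\ exists y, hole X E eta x r y]]
    : set (BorRn R n)).
Proof.
move=> Xx0 eta01; have /andP[eta0 _] := eta01.
set S := [set x | _].
have [|C C0 HC] := doubling_ball dmu (_ : 0 < 7 / eta); first exact: divr_gt0.
pose H := closure E `&` [set x | `|x0 - x| <= k%:R].
have cH : closed H.
  apply: closedI; first exact: closed_closure.
  rewrite (_ : [set x | _] = closed_ball_ Num.norm x0 k%:R)//.
  exact: closed_closed_ball_.
have mH := closed_measurable_BorRn cH.
pose U (i : nat) : set 'rV[R]_n := \bigcup_(z in H) ball z (i.+1%:R^-1).
have mU i : measurable (U i : set (BorRn R n)).
  by apply: open_measurable_BorRn; apply: bigcup_open => z _; exact: ball_open.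
have invS_gt0 (i : nat) : 0 < (i.+1%:R^-1 : R) by rewrite invr_gt0.
have /choice[W HW] : forall i : nat, exists W : set 'rV[R]_n, [/\ open W, S `<=` W &
    (mu W <= C%:E * mu (U i `\` H))%E].
  (* Half of the width of [U i] is used because [porous_cover] asks for balls of radius [2 * d]
     inside it. *)
  move=> i; apply: (@porous_cover _ _ X mu E (U i) H S eta (i.+1%:R^-1 / 2) C) => //.
  - by move=> x [].
  - move=> x [Xx Ex x0x _] y; rewrite mulrC divfK// => xy.
    by exists x.
  - move=> x [_ _ _ /(_ (i.+1%:R^-1 / 2))[|r [/andP[r0 r1] hr]]].
      by rewrite divr_gt0.
    by exists r; split => //; rewrite r0 ltW.
have mW i : measurable (W i : set (BorRn R n)).
  by apply: open_measurable_BorRn; have [] := HW i.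
exists (\bigcap_i W i); split.
- exact: bigcapT_measurable.
- apply/eqP; rewrite eq_le measure_ge0 andbT.
  have F0 : mu (U i `\` H) @[i --> \oo] --> 0%E.
    rewrite -(measure0 mu).
    have <- : \bigcap_i (U i `\` H) = set0.
      apply/seteqP; split => // x Hx; have [_ nHx] := Hx 0%N I.
      apply: nHx; apply: cH => B /nbhs_ballP[e /= e0 eB].
      have [z Hz zx] := (Hx (Num.bound e^-1) I).1.
      exists z; split => //; apply: eB; apply: ball_sym.
      apply: le_ball zx; rewrite invf_ple ?posrE//.
      by rewrite ltW// (lt_trans (archi_boundP _)) ?ltr_nat// invr_ge0 ltW.
    (* Continuity from above needs finite measure, which holds since [U 0] lies in a ball of radius
       [k + 1]. *)
    apply: (@nonincreasing_cvg_mu _ _ _ mu).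
    - apply: (@le_lt_trans _ _ (mu (ball x0 (k%:R + 1)))).
        apply: le_measure; rewrite ?inE.
        + exact: measurableD.
        + exact: ball_measurable_BorRn.
        + move=> x [[z [_ /= x0z] zx] _]; rewrite ball_norm_lt.
          move: zx; rewrite ball_norm_lt invr1 => zx.
          rewrite (_ : x0 - x = (x0 - z) + (z - x)); last by rewrite addrA subrK.
          by apply: (le_lt_trans (ler_normD _ _)); exact: ler_ltD.
      by apply: (doubling_ball_lty dmu) => //; rewrite ltr_wpDl.
    - by move=> i; exact: measurableD.
    - by apply: bigcapT_measurable => i; exact: measurableD.
    - move=> i j ij; apply/subsetPset => x [[z Hz zx] nHx]; split => //.
      exists z => //; apply: le_ball zx.
      by rewrite lef_pV2 ?posrE// ler_nat.
  have CF0 : (C%:E * mu (U i `\` H))%E @[i --> \oo] --> 0%E.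
    by rewrite -(mule0 C%:E); apply: cvgeZl.
  rewrite -(cvg_lim _ CF0)//; apply: lime_ge; first by apply/cvg_ex; exists 0%E.
  apply: nearW => i; have [_ _] := HW i; apply: le_trans.
  apply: le_measure; rewrite ?inE//; first exact: bigcapT_measurable.
  exact: bigcap_inf.
- by move=> x Sx i _; have [_ + _] := HW i; apply.
Qed.

(** A hole for [eta] is also a hole for any smaller constant, so the constants 1/(j+1) and the
    bounds [k] on the distance to [x0] give a countable union of null sets. *)
Lemma doubling_ae_nonporous (E : set 'rV[R]_n) :
  exists N : set (BorRn R n), mu.-negligible N /\
    forall x, X x -> closure E x -> ~ N x -> nonporous_at X E x.
Proof.
have [[x0 Xx0]|X0] := pselect (X !=set0); last first.
  exists set0; split; first exact: negligible_set0.
  by move=> x Xx; exfalso; apply: X0; exists x.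
pose S (j k : nat) : set (BorRn R n) := [set x | [/\ X x, closure E x, `|x0 - x| <= k%:R &
    forall rho, 0 < rho -> exists r, 0 < r < rho /\ exists y, hole X E (j.+1%:R^-1) x r y]].
exists (\bigcup_j \bigcup_k S j k); split.
  apply: negligible_bigcup => j; apply: negligible_bigcup => k.
  apply: negligible_porous_bounded => //.
  by rewrite invr_gt0 ltr0Sn/= invf_le1 ?ltr0Sn// ler1n.
move=> x Xx Ex Nx eta eta0; apply: contrapT => noeta; apply: Nx.
exists (Num.bound eta^-1) => //; exists (Num.bound `|x0 - x|) => //; split => //.
  by rewrite ltW// archi_boundP.
move=> rho rho0; apply: contrapT => norho; apply: noeta.
exists rho => // r rr y Xy xy; apply: contrapT => noz; apply: norho.
exists r; split => //; exists y; split => // z Ez.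
rewrite leNgt; apply/negP => zy; apply: noz; exists z => //.
apply: (lt_le_trans zy); have /andP[r0 _] := rr; rewrite ler_pM2r//.
rewrite invf_ple ?posrE//.
by rewrite ltW// (lt_trans (archi_boundP _)) ?ltr_nat// invr_ge0 ltW.
Qed.

End porosity.

(** * Infinitesimal translations *)

(* First-order invariance of [X] near [x] under translation by [v], with [phi]
   changing at rate [w]; uniform over all base points [y] near [x]. *)
Definition flow_dir {R : realType} {n m : nat} (X : set 'rV[R]_n)
    (phi : 'rV[R]_n -> 'rV[R]_m) (x v : 'rV[R]_n) (w : 'rV[R]_m) :=
  forall eps, 0 < eps -> exists2 rho, 0 < rho &
    forall r, 0 < r < rho -> forall y, X y -> `|x - y| <= r ->
      forall s : R, `|s| <= r ->
        exists y', [/\ X y', `|y' - (y + s *: v)| <= eps * r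
                         & `|phi y' - (phi y + s *: w)| <= eps * r].

Lemma lipschitz_on_norm {R : realType} {n m : nat} (X : set 'rV[R]_n)
    (phi : 'rV[R]_n -> 'rV[R]_m) :
  lipschitz_on X phi -> exists2 L : R, 0 <= L &
    forall x y, X x -> X y -> `|phi x - phi y| <= L * `|x - y|.
Proof.
move=> [L HL]; exists (`|L| * n%:R); first by rewrite mulr_ge0.
move=> x y Xx Xy; apply: (le_trans (norm_le_enorm _)).
apply: (le_trans (HL _ _ Xx Xy)); rewrite -mulrA.
apply: (@le_trans _ _ (`|L| * edist x y)).
  by rewrite ler_wpM2r ?enorm_ge0// ler_norm.
by rewrite ler_wpM2l// enorm_le_norm.
Qed.

Section flow_dir.
Context {R : realType} {n m : nat} (X : set 'rV[R]_n).
Variable (phi : 'rV[R]_n -> 'rV[R]_m).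
Variable x : 'rV[R]_n.

Lemma flow_dir0 : flow_dir X phi x 0 0.
Proof.
move=> e e0; exists 1 => // r /andP[r0 _] y Xy _ s _; exists y.
by rewrite !scaler0 !addr0 !subrr !normr0; split => //; rewrite mulr_ge0// ltW.
Qed.

Lemma flow_dirZ a v w : flow_dir X phi x v w -> flow_dir X phi x (a *: v) (a *: w).
Proof.
(* Working at scale [M * r] makes both the displacement [s * a] and the base point admissible. *)
move=> H e e0; pose M := 1 + `|a|.
have M0 : 0 < M by rewrite ltr_pwDl.
have a0 : 0 <= `|a| by [].
have [rho rho0 Hrho] := H _ (divr_gt0 e0 M0).
exists (rho / M); first exact: divr_gt0.
move=> r /andP[r0 rr] y Xy xy s sr.
have [|||y' [Xy' h1 h2]] := Hrho (M * r) _ y Xy _ (s * a).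
- by rewrite mulr_gt0//= mulrC -ltr_pdivlMr.
- by apply: (le_trans xy); rewrite ler_peMl ?(ltW r0)// /M lerDl.
- rewrite normrM mulrC; by apply: ler_pM; rewrite // /M lerDr.
have E : e / M * (M * r) = e * r by rewrite mulrA divfK// gt_eqF.
by exists y'; split; rewrite // !scalerA -E.
Qed.

(** Move along [v], then along [v'] from the point reached. This is where the uniformity of
    [flow_dir] over base points near [x] is essential. *)
Lemma flow_dirD v w v' w' : flow_dir X phi x v w -> flow_dir X phi x v' w' ->
  flow_dir X phi x (v + v') (w + w').
Proof.
(* The intermediate point is within [r + r * |v| + r] of [x]; the last [r] bounds the first error,
   whence the minimum with 1 below. *)
move=> H H' e e0; pose M := 2 + `|v|.
have M0 : 0 < M by rewrite ltr_pwDl.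
have v0 : 0 <= `|v| by [].
have e10 : 0 < Num.min (e / 2) 1 by rewrite lt_min ltr01 divr_gt0.
have e20 : 0 < e / 2 / M by rewrite !divr_gt0.
have [rho1 rho10 H1] := H _ e10.
have [rho2 rho20 H2] := H' _ e20.
exists (Num.min rho1 (rho2 / M)); first by rewrite lt_min rho10 divr_gt0.
move=> r /andP[r0]; rewrite lt_min => /andP[rr1 rr2] y Xy xy s sr.
have [||y1 [Xy1 h1 h2]] := H1 r _ y Xy xy s; [by rewrite r0|by []|].
have h1e : `|y1 - (y + s *: v)| <= e / 2 * r.
  by apply: (le_trans h1); rewrite ler_wpM2r ?(ltW r0)// ge_min lexx.
have h11 : `|y1 - (y + s *: v)| <= r.
  by apply: (le_trans h1); rewrite ler_piMl ?(ltW r0)// ge_min lexx orbT.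
have h2e : `|phi y1 - (phi y + s *: w)| <= e / 2 * r.
  by apply: (le_trans h2); rewrite ler_wpM2r ?(ltW r0)// ge_min lexx.
have sv : `|s *: v| <= r * `|v| by rewrite normrZ ler_wpM2r.
have rM : r <= M * r by rewrite ler_peMl ?(ltW r0)// /M; lra.
have [|||y2 [Xy2 h3 h4]] := H2 (M * r) _ y1 Xy1 _ s.
- by rewrite mulr_gt0//= mulrC -ltr_pdivlMr.
- rewrite (_ : x - y1 = (x - y) - s *: v - (y1 - (y + s *: v))); last first.
    by apply/rowP => i; rewrite !mxE; ring.
  apply: (le_trans (ler_normB _ _)).
  have := ler_normB (x - y) (s *: v); rewrite /M mulrDl (mulrC `|v|); lra.
- exact: le_trans rM.
have E : e / 2 / M * (M * r) = e / 2 * r by rewrite mulrA divfK// gt_eqF.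
rewrite E in h3 h4.
exists y2; split => //.
- rewrite (_ : y2 - _ = (y2 - (y1 + s *: v')) + (y1 - (y + s *: v))); last first.
    by apply/rowP => i; rewrite !mxE; ring.
  by apply: (le_trans (ler_normD _ _)); lra.
- rewrite (_ : phi y2 - _ = (phi y2 - (phi y1 + s *: w')) + (phi y1 - (phi y + s *: w))); last first.
    by apply/rowP => i; rewrite !mxE; ring.
  by apply: (le_trans (ler_normD _ _)); lra.
Qed.

Lemma flow_dir_mulmx k (V : 'M[R]_(k, n)) (W : 'M[R]_(k, m)) (a : 'rV[R]_k) :
  (forall i, flow_dir X phi x (row i V) (row i W)) ->
  flow_dir X phi x (a *m V) (a *m W).
Proof.
move=> H; rewrite !mulmx_sum_row.
elim/big_rec2: _ => [|i w v _ IH]; first exact: flow_dir0.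
by apply: flow_dirD => //; exact: flow_dirZ.
Qed.

(** With [v = 0] the point reached stays within [e * r] of [x], so [phi] moves by at most
    [L * e * r], yet it should move by about [r * |w|]. The choice of [e] makes the total error half
    of [r * |w|]. *)
Lemma flow_dir_eq0 w : lipschitz_on X phi -> X x -> flow_dir X phi x 0 w -> w = 0.
Proof.
move=> /lipschitz_on_norm[L L0 HL] Xx H; apply/eqP; rewrite -normr_eq0.
apply/negPn/negP => w0.
have {}w0 : 0 < `|w| by rewrite lt_neqAle eq_sym w0 normr_ge0.
have L1 : 0 < 2 * (1 + L) by rewrite mulr_gt0// ltr_wpDr.
have [rho rho0 /(_ (rho / 2))] := H _ (divr_gt0 w0 L1).
set r := rho / 2; set e := _ / _.
have r0 : 0 < r by rewrite divr_gt0.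
have e0 : 0 < e by rewrite divr_gt0.
have rrho : r < rho by rewrite ltr_pdivrMr// ltr_pMr// ltr1n.
move=> /(_ _ x Xx _ r)[|||y' [Xy' h1 h2]].
- by rewrite r0.
- by rewrite subrr normr0 ltW.
- by rewrite gtr0_norm.
rewrite scaler0 addr0 in h1.
have h3 := HL _ _ Xy' Xx.
have h4 : `|phi y' - phi x| <= L * (e * r) by apply: (le_trans h3); rewrite ler_wpM2l.
have h5 : r * `|w| <= e * r + L * (e * r).
  rewrite -{1}(gtr0_norm r0) -normrZ.
  rewrite (_ : r *: w = (phi y' - phi x) - (phi y' - (phi x + r *: w))); last first.
    by apply/rowP => i; rewrite !mxE; ring.
  by apply: (le_trans (ler_normB _ _)); rewrite addrC; exact: lerD.
have h6 : e * r + L * (e * r) = r * `|w| / 2.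
  by rewrite /e; field; rewrite gt_eqF// ltr_wpDr.
have : 0 < r * `|w| by rewrite mulr_gt0.
lra.
Qed.

Lemma dR_lt_left (r e : R) (A B : set 'rV[R]_n) (a : 'rV[R]_n) :
  (dR r A B < e%:E)%E -> A a -> enorm a <= r -> exists2 b, B b & edist a b < e.
Proof.
rewrite /dR gt_max => /andP[h _] Aa ar.
have : (dist_to a B < e%:E)%E.
  by apply: le_lt_trans h; apply: ereal_sup_ubound; exists a.
by move/ereal_inf_lt => [_ [b Bb <-]]; rewrite lte_fin => ?; exists b.
Qed.

Lemma dR_lt_right (r e : R) (A B : set 'rV[R]_n) (b : 'rV[R]_n) :
  (dR r A B < e%:E)%E -> B b -> enorm b <= r -> exists2 a, A a & edist b a < e.
Proof.
rewrite /dR gt_max => /andP[_ h] Bb br.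
have : (dist_to b A < e%:E)%E.
  by apply: le_lt_trans h; apply: ereal_sup_ubound; exists b.
by move/ereal_inf_lt => [_ [a Aa <-]]; rewrite lte_fin => ?; exists a.
Qed.

(** Approximate [y] by a rescaled point of [X], move that point along [v] inside [X], rescale, and
    approximate the result by [Y], which is closed. *)
Lemma tangent_translate v w (Y : set 'rV[R]_n) y :
  flow_dir X phi x v w -> intrinsic_tangent X x Y -> Y y -> Y (y + v).
Proof.
move=> H [lam [lam0 lamcvg [cY HY]]] Yy.
apply: cY => B /nbhs_ballP[e /= e0 eB].
suff [y2 Yy2 h] : exists2 y2, Y y2 & `|y + v - y2| < e.
  by exists y2; split => //; apply: eB; rewrite ball_norm_lt.
(* Three errors occur, each at most [e1]: to [X], along the flow, and back to [Y]. *)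
pose e1 := Num.min e 1 / 4.
have e10 : 0 < e1 by rewrite divr_gt0// lt_min e0 ltr01.
have e1e : 4 * e1 <= e by rewrite /e1 mulrC divfK// ge_min lexx.
have e11 : 4 * e1 <= 1 by rewrite /e1 mulrC divfK// ge_min lexx orbT.
pose K := `|y| + 2.
have y0 : 0 <= `|y| by [].
have v0 : 0 <= `|v| by [].
have K0 : 0 < K by rewrite ltr_wpDl.
(* The window contains both [y] and the translated approximant; [n] converts sup norm to Euclidean
   norm. *)
pose r0 := enorm y + n%:R * (`|y| + `|v| + 2) + 1.
have nyv : 0 <= n%:R * (`|y| + `|v| + 2) by rewrite mulr_ge0// !addr_ge0.
have ey0 := enorm_ge0 y.
have r00 : 0 < r0 by rewrite /r0; lra.
have [N1 HN1] := HY _ r00 _ e10.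
have [rho rho0 Hrho] := H _ (divr_gt0 e10 K0).
have [j [jN jrho]] : exists j, (N1 <= j)%N /\ lam j * K < rho.
  have rK : 0 < rho / K by rewrite divr_gt0.
  move/cvgrPdist_lt : lamcvg => /(_ _ rK)[N2 _ HN2].
  exists (maxn N1 N2); split; first exact: leq_maxl.
  have := HN2 (maxn N1 N2) (leq_maxr _ _).
  by rewrite /= sub0r normrN (gtr0_norm (lam0 _)) ltr_pdivlMr.
have [|_ [a Xa <-] ya] := dR_lt_right (HN1 _ jN) Yy; first by rewrite /r0; lra.
have l0 := lam0 j; set l := lam j in l0 ya jrho *.
have {}ya : `|y - l^-1 *: (a - x)| < e1 by apply: le_lt_trans ya; exact: norm_le_enorm.
have lK (u : 'rV[R]_n) : `|u| = l * `|l^-1 *: u|.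
  by rewrite normrZ gtr0_norm ?invr_gt0// mulrA divff ?mul1r// gt_eqF.
have ax : `|l^-1 *: (a - x)| <= `|y| + e1.
  rewrite (_ : l^-1 *: (a - x) = y - (y - l^-1 *: (a - x))); last by rewrite subKr.
  by apply: (le_trans (ler_normB _ _)); lra.
have [|||y' [Xy' h1 _]] := Hrho (l * K) _ a Xa _ l.
- by rewrite mulr_gt0.
- by rewrite distrC lK ler_wpM2l ?(ltW l0)// /K; lra.
- by rewrite gtr0_norm// ler_peMr ?(ltW l0)// /K; lra.
have h2 : `|l^-1 *: (y' - x) - (l^-1 *: (a - x) + v)| <= e1.
  have -> : l^-1 *: (y' - x) - (l^-1 *: (a - x) + v) = l^-1 *: (y' - (a + l *: v)).
    by apply/rowP => i; rewrite !mxE; field; rewrite gt_eqF.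
  rewrite normrZ gtr0_norm ?invr_gt0// ler_pdivrMl//.
  by rewrite (le_trans h1)// (_ : e1 / K * (l * K) = l * e1)//; field; rewrite gt_eqF.
have [||y2 Yy2 hy2] := @dR_lt_left _ _ _ _ (l^-1 *: (y' - x)) (HN1 _ jN).
- by exists y'.
- apply: (le_trans (enorm_le_norm _)); rewrite /r0.
  have : n%:R * `|l^-1 *: (y' - x)| <= n%:R * (`|y| + `|v| + 2); last lra.
  rewrite ler_wpM2l//.
  rewrite (_ : l^-1 *: (y' - x) =
    (l^-1 *: (y' - x) - (l^-1 *: (a - x) + v)) + (l^-1 *: (a - x) + v)); last by rewrite subrK.
  apply: (le_trans (ler_normD _ _)).
  by have := ler_normD (l^-1 *: (a - x)) v; lra.
exists y2 => //.
have {}hy2 : `|l^-1 *: (y' - x) - y2| < e1 by apply: le_lt_trans hy2; exact: norm_le_enorm.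
rewrite (_ : y + v - y2 = (y - l^-1 *: (a - x)) +
   ((l^-1 *: (y' - x) - y2) - (l^-1 *: (y' - x) - (l^-1 *: (a - x) + v)))); last first.
  by apply/rowP => i; rewrite !mxE; ring.
apply: (le_lt_trans (ler_normD _ _)).
have := ler_normB (l^-1 *: (y' - x) - y2) (l^-1 *: (y' - x) - (l^-1 *: (a - x) + v)).
lra.
Qed.

End flow_dir.

(** * Orthogonal projection and translation-invariant sets *)

Lemma dotv_mulmx {R : realType} {n : nat} (u v : 'rV[R]_n) : dotv u v = (u *m v^T) 0 0.
Proof. by rewrite mxE; apply: eq_bigr => i _; rewrite mxE. Qed.

Lemma dotv_eq0 {R : realType} {n : nat} (v : 'rV[R]_n) : dotv v v = 0 -> v = 0.
Proof.
move=> /eqP; rewrite psumr_eq0 => [/allP h|i _]; last by rewrite -expr2 sqr_ge0.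
apply/rowP => j; rewrite mxE; apply/eqP.
by have := h j (mem_index_enum j); rewrite mulf_eq0 orbb.
Qed.

(** The projection is given by the Gram matrix of a row basis [B], invertible because
    [u *m B *m B^T = 0] forces [u *m B] to have norm 0. *)
Lemma orthogonal_decomposition {R : realType} {n : nat} (V : 'M[R]_n) (y : 'rV[R]_n) :
  exists2 v : 'rV[R]_n, (v <= V)%MS & orth_compl V (y - v).
Proof.
pose B := row_base V.
have Bu : B *m B^T \in unitmx.
  rewrite -row_free_unit; apply/row_freeP.
  apply/row_freeP; rewrite -kermx_eq0; apply/rowV0P => u.
  rewrite sub_kermx => /eqP; rewrite mulmxA => uBB.
  have : dotv (u *m B) (u *m B) = 0.
    by rewrite dotv_mulmx trmx_mul mulmxA uBB mul0mx mxE.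
  move/dotv_eq0 => uB0; have := row_base_free V.
  by rewrite -kermx_eq0 => /rowV0P; apply; rewrite sub_kermx uB0.
exists (y *m B^T *m invmx (B *m B^T) *m B).
  by rewrite (submx_trans (submxMl _ _))// eq_row_base.
move=> w; rewrite -(eq_row_base V) => /submxP[u ->].
rewrite dotv_mulmx (trmx_mul u) mulmxA.
suff -> : (y - y *m B^T *m invmx (B *m B^T) *m B) *m B^T = 0 by rewrite mul0mx mxE.
rewrite mulmxBl -(mulmxA _ B) -(mulmxA _ (invmx _)) mulVmx// mulmx1.
exact: subrr.
Qed.

(** Take [Z] to be the part of [Y] orthogonal to [V]: subtracting from [y] its projection on [V]
    stays in [Y]. *)
Lemma translation_invariant_product {R : realType} {n : nat} (V : 'M[R]_n)
    (Y : set 'rV[R]_n) : closed Y ->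
  (forall y v, Y y -> (v <= V)%MS -> Y (y + v)) ->
  exists Z : set 'rV[R]_n, [/\ closed Z, Z `<=` orth_compl V &
    Y = [set z + v | z in Z & v in [set v : 'rV[R]_n | (v <= V)%MS]]].
Proof.
move=> cY YV; exists (Y `&` orth_compl V); split; [|by move=> ? []|].
  apply: closedI => //.
  have -> : orth_compl V = \bigcap_(v in [set v : 'rV[R]_n | (v <= V)%MS])
      ((fun z => dotv z v) @^-1` [set 0]).
    by apply/seteqP; split => z h v /=; exact: h.
  apply: closed_bigI => v _; apply: closed_comp; last exact: closed_eq.
  by move=> z _; exact: dotv_continuous.
apply/seteqP; split => [y Yy|_ [z [Yz _] [v Vv <-]]]; last exact: YV.
have [v Vv yv] := orthogonal_decomposition V y.
exists (y - v); first by split => //; apply: YV => //; rewrite eqmx_opp.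
by exists v => //; rewrite subrK.
Qed.

(** * Fragments and Alberti representations *)

Lemma negligible_bigcup_countType d (T : measurableType d) (R : realType)
    (mu : {measure set T -> \bar R}) (I : countType) (F : I -> set T) :
  (forall i, mu.-negligible (F i)) -> mu.-negligible (\bigcup_i F i).
Proof.
move=> HF.
pose G n := if unpickle n is Some i then F i else set0.
apply: (@negligibleS _ _ _ mu (\bigcup_n G n)).
  by move=> x [i _ Fx]; exists (pickle i); rewrite // /G pickleK.
apply: negligible_bigcup => n; rewrite /G; case: unpickle => [i|]; first exact: HF.
exact: negligible_set0.
Qed.

(* No measurability of [f] is required, hence the detour through simple functions. *)
Lemma integral_eq0_off_null d (T : measurableType d) (R : realType)
    (mu : {measure set T -> \bar R}) (D N : set T) (f : T -> \bar R) :
  measurable N -> mu N = 0%E -> (forall x, D x -> (0 <= f x)%E) ->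
  (forall x, D x -> ~ N x -> f x = 0%E) -> (\int[mu]_(x in D) f x = 0)%E.
Proof.
move=> mN N0 f0 fN; apply/eqP; rewrite eq_le integral_ge0 ?andbT//.
rewrite ge0_integralE//; apply: ge_ereal_sup => _ [h /= hf <-].
rewrite -integralT_nnsfun (ge0_negligible_integral mN)//=.
- rewrite integral0_eq// => x [_ Nx].
  apply/eqP; rewrite eq_le; apply/andP; split; last first.
    by rewrite lee_fin; exact: fun_ge0.
  apply: (le_trans (hf x)); rewrite patchE; case: ifPn => //.
  by rewrite inE => Dx; rewrite fN.
- exact/measurable_EFinP.
- by move=> x _; rewrite lee_fin.
Qed.

(** Otherwise an interval of length [2 * (eta * |s|)] about [t + s] misses [C]. It fills the
    fraction eta / (1 + eta) of the interval of radius [(1 + eta) * |s|] about [t], against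
    density. *)
Lemma density_point_near {R : realType} (C : set R) (t eta : R) :
  measurable C -> C t -> density_point C t -> 0 < eta ->
  exists2 d, 0 < d & forall s, `|s| < d -> exists2 t', C t' & `|t' - (t + s)| <= eta * `|s|.
Proof.
move=> mC Ct dC eta0.
have e0 : 0 < eta / (1 + eta) by rewrite divr_gt0// addr_gt0.
have [d d0 Hd] := dC _ e0.
have e1 : 0 < 1 + eta by rewrite addr_gt0.
exists (d / (1 + eta)); first by rewrite divr_gt0.
move=> s sd; have [->|s0] := eqVneq s 0.
  by exists t; rewrite // addr0 subrr normr0 mulr0.
apply: contrapT => nos.
have s_gt0 : 0 < `|s| by rewrite normr_gt0.
pose r := (1 + eta) * `|s|.
have r0 : 0 < r by rewrite mulr_gt0.
have rd : r < d by rewrite /r mulrC -ltr_pdivlMr.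
pose J := `[t + s - eta * `|s|, t + s + eta * `|s|]%classic.
pose I := `[t - r, t + r]%classic.
have es0 : 0 < eta * `|s| by rewrite mulr_gt0.
have rE : r = `|s| + eta * `|s| by rewrite /r mulrDl mul1r.
have sr : - `|s| <= s <= `|s| by rewrite -ler_norml.
have JI : J `<=` I.
  move=> u; rewrite /J /I /= !in_itv/= => /andP[h1 h2].
  by move/andP: sr => [? ?]; apply/andP; split; lra.
have mJ : (lebesgue_measure J = (2 * (eta * `|s|))%:E)%E.
  rewrite lebesgue_measure_itv/= lte_fin ifT; last by lra.
  by rewrite -EFinD; congr EFin; ring.
have mI : (lebesgue_measure I = (2 * r)%:E)%E.
  rewrite lebesgue_measure_itv/= lte_fin ifT; last by lra.
  by rewrite -EFinD; congr EFin; ring.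
have measI : measurable I by exact: measurable_itv.
have measJ : measurable J by exact: measurable_itv.
have CJ0 : (C `&` I) `&` J = set0.
  apply/seteqP; split => // u [[Cu _] Ju]; apply: nos; exists u => //.
  move: Ju; rewrite /J /= in_itv/= => /andP[? ?].
  by rewrite ler_norml; apply/andP; split; lra.
have le1 : (lebesgue_measure (C `&` I) + (2 * (eta * `|s|))%:E <= (2 * r)%:E)%E.
  rewrite -mJ -mI -measureU//; last exact: measurableI.
  apply: le_measure; rewrite ?inE//; last by move=> u [[]|/JI].
  by apply: measurableU => //; exact: measurableI.
have := Hd r r0 rd; rewrite -/I.
have : (0 <= lebesgue_measure (C `&` I))%E by exact: measure_ge0.
move: le1; case: (lebesgue_measure _) => [c| |]//.
rewrite -EFinD !lee_fin -EFinM -EFinB => le1 c0.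
rewrite /= lte_fin distrC => h.
have h2 : 1 - c * (2 * r)^-1 < eta / (1 + eta) by apply: le_lt_trans h; exact: ler_norm.
have h3 : eta / (1 + eta) = (2 * (eta * `|s|)) * (2 * r)^-1.
  by rewrite /r; field; rewrite !gt_eqF.
have r20 : 0 < 2 * r by rewrite mulr_gt0.
have : (1 - c * (2 * r)^-1) * (2 * r) < eta / (1 + eta) * (2 * r) by rewrite ltr_pM2r.
by rewrite h3 mulrBl mul1r !divfK ?gt_eqF//; lra.
Qed.

Section flow_set.
Context {R : realType} {n m : nat} (X : set 'rV[R]_n).
Variable (phi : 'rV[R]_n -> 'rV[R]_m).

(** Unlike in [flow_dir], only the point [x] itself is moved; non-porosity will supply the
    uniformity over nearby base points. *)
Definition flow_set (v : 'rV[R]_n) (w : 'rV[R]_m) (eps d : R) : set 'rV[R]_n :=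
  [set x | X x /\ forall s : R, `|s| < d -> exists y,
     [/\ X y, `|y - (x + s *: v)| <= eps * `|s|
            & `|phi y - (phi x + s *: w)| <= eps * `|s|]].

(** Changing the direction by [e'] costs [e' * |s|], which permits rational directions. *)
Lemma flow_set_perturb v w v' w' e e' d x : flow_set v w e d x ->
  `|v - v'| <= e' -> `|w - w'| <= e' -> flow_set v' w' (e + e') d x.
Proof.
move=> [Xx H] vv ww; split => // s sd; have [y [Xy h1 h2]] := H s sd.
exists y; split => //.
- rewrite (_ : y - _ = (y - (x + s *: v)) + s *: (v - v')); last first.
    by apply/rowP => i; rewrite !mxE; ring.
  apply: (le_trans (ler_normD _ _)); rewrite mulrDl normrZ; apply: lerD => //.
  by rewrite mulrC ler_wpM2r.
- rewrite (_ : phi y - _ = (phi y - (phi x + s *: w)) + s *: (w - w')); last first.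
    by apply/rowP => i; rewrite !mxE; ring.
  apply: (le_trans (ler_normD _ _)); rewrite mulrDl normrZ; apply: lerD => //.
  by rewrite mulrC ler_wpM2r.
Qed.

(** By non-porosity a base point [y] is within [e * r] of a point [z] of the flow set, and [z] is
    moved instead. The shift to [z], the flow and the change of direction cost at most
    [(3 + L) * e * r], with [L] accounting for the shift under [phi]. *)
Lemma flow_dir_of_flow_sets v w x : lipschitz_on X phi ->
  (forall e, 0 < e -> exists v' w' d, [/\ 0 < d, `|v - v'| <= e, `|w - w'| <= e
     & nonporous_at X (flow_set v' w' e d) x]) ->
  flow_dir X phi x v w.
Proof.
move=> /lipschitz_on_norm[L L0 HL] H e0 e00.
have L3 : 0 < 3 + L by lra.
pose e := e0 / (3 + L).
have e_gt0 : 0 < e by rewrite divr_gt0.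
have eE : 3 * e + L * e = e0 by rewrite /e; field; rewrite gt_eqF.
have [v' [w' [d [d0 vv ww np]]]] := H _ e_gt0.
have [rho rho0 Hrho] := np _ e_gt0.
exists (Num.min rho d); first by rewrite lt_min rho0.
move=> r /andP[r0]; rewrite lt_min => /andP[rr rd] y Xy xy s sr.
have [|z [Xz Hz] zy] := Hrho r _ y Xy xy; first by rewrite r0.
have [|y' [Xy' h1 h2]] := Hz s; first exact: le_lt_trans rd.
have esr : e * `|s| <= e * r by rewrite ler_wpM2l// ltW.
have Ler : 0 <= L * e * r by apply: mulr_ge0 (ltW r0); apply: mulr_ge0 L0 (ltW e_gt0).
have ev : `|s *: (v' - v)| <= e * r.
  by rewrite normrZ mulrC distrC; apply: ler_pM.
have ew : `|s *: (w' - w)| <= e * r.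
  by rewrite normrZ mulrC distrC; apply: ler_pM.
have Lzy : `|phi z - phi y| <= L * e * r.
  by apply: (le_trans (HL _ _ Xz Xy)); rewrite -mulrA ler_wpM2l// ltW.
exists y'; split => //.
- rewrite (_ : y' - _ = (y' - (z + s *: v')) + (z - y) + s *: (v' - v)); last first.
    by apply/rowP => i; rewrite !mxE; ring.
  apply: (le_trans (ler_normD _ _)).
  have := ler_normD (y' - (z + s *: v')) (z - y).
  rewrite -eE mulrDl; lra.
- rewrite (_ : phi y' - _ = (phi y' - (phi z + s *: w')) + (phi z - phi y) + s *: (w' - w)); last first.
    by apply/rowP => i; rewrite !mxE; ring.
  apply: (le_trans (ler_normD _ _)).
  have := ler_normD (phi y' - (phi z + s *: w')) (phi z - phi y).
  have er0 : 0 <= e * r by apply: mulr_ge0 (ltW e_gt0) (ltW r0).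
  rewrite -eE mulrDl; lra.
Qed.

(** By density some [t'] in [C] is very close to [t + s], and [g t'] is the required point. *)
Lemma fragment_flow_set (C : set R) (g : R -> 'rV[R]_n) t v w :
  measurable C -> g @` C `<=` X -> C t ->
  (forall e, 0 < e -> \forall t' \near t, C t' ->
     `|g t' - g t - (t' - t) *: v| <= e * `|t' - t|) ->
  density_point C t ->
  (forall e, 0 < e -> exists2 d, 0 < d & forall t', C t' -> 0 < `|t' - t| < d ->
     `|phi (g t') - phi (g t) - (t' - t) *: w| <= e * `|t' - t|) ->
  forall e, 0 < e -> exists2 d, 0 < d & flow_set v w e d (g t).
Proof.
move=> mC gX Ct Hv dC Hw e e0.
have v0 : 0 <= `|v| by [].
have w0 : 0 <= `|w| by [].
have M0 : 0 < 2 * (1 + `|v| + `|w|) by rewrite mulr_gt0// ltr_wpDr// ltr_wpDr.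
(* The bound 1/2 gives [t' != t] and [|t' - t| <= 2 * |s|]; the other makes the error from replacing
   [t + s] by [t'] at most [e / 2 * |s|]. *)
pose eta := Num.min (1/2) (e / (2 * (1 + `|v| + `|w|))).
have eta0 : 0 < eta by rewrite lt_min divr_gt0//= divr_gt0.
have eta12 : eta <= 1 / 2 by rewrite ge_min lexx.
have etae : eta * (2 * (1 + `|v| + `|w|)) <= e.
  by rewrite -ler_pdivlMr// ge_min lexx orbT.
have e4 : 0 < e / 4 by rewrite divr_gt0.
have [d1 d10 H1] := density_point_near mC Ct dC eta0.
have /nbhs_ballP[d2 /= d20 H2] := Hv _ e4.
have [d3 d30 H3] := Hw _ e4.
exists (Num.min d1 (Num.min (d2 / 2) (d3 / 2))).
  by rewrite !lt_min d10 !divr_gt0.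
split; first by apply: gX; exists t.
move=> s; rewrite !lt_min => /andP[s1 /andP[s2 s3]].
have [->|s0] := eqVneq s 0.
  exists (g t); rewrite !scale0r !addr0 !subrr !normr0 mulr0; split => //.
  by apply: gX; exists t.
have s_gt0 : 0 < `|s| by rewrite normr_gt0.
have [t' Ct' tt'] := H1 s s1.
have es : eta * `|s| <= 1 / 2 * `|s| by rewrite ler_wpM2r// ltW.
have up : `|t' - t| <= 2 * `|s|.
  rewrite (_ : t' - t = (t' - (t + s)) + s); last by ring.
  by apply: (le_trans (ler_normD _ _)); lra.
have lo : 0 < `|t' - t|.
  rewrite normr_gt0; apply/eqP => /subr0_eq E.
  move: tt'; rewrite E (_ : t - (t + s) = - s) ?normrN; last by ring.
  lra.
have h2 : `|g t' - g t - (t' - t) *: v| <= e / 2 * `|s|.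
  apply: (le_trans (H2 t' _ Ct')).
    by rewrite /ball /= distrC (le_lt_trans up)//; lra.
  have : e / 4 * `|t' - t| <= e / 4 * (2 * `|s|) by rewrite ler_wpM2l// ltW.
  lra.
have h3 : `|phi (g t') - phi (g t) - (t' - t) *: w| <= e / 2 * `|s|.
  apply: (le_trans (H3 t' Ct' _)).
    by rewrite lo (le_lt_trans up)//; lra.
  have : e / 4 * `|t' - t| <= e / 4 * (2 * `|s|) by rewrite ler_wpM2l// ltW.
  lra.
have bnd (k : nat) (u : 'rV[R]_k) : `|u| <= `|v| + `|w| ->
    `|(t' - (t + s)) *: u| <= e / 2 * `|s|.
  move=> uvw; rewrite normrZ.
  apply: (@le_trans _ _ (eta * `|s| * (1 + `|v| + `|w|))).
    by apply: ler_pM => //; lra.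
  rewrite mulrAC ler_wpM2r//; lra.
exists (g t'); split; first by apply: gX; exists t'.
- rewrite (_ : g t' - _ = (g t' - g t - (t' - t) *: v) + (t' - (t + s)) *: v); last first.
    by apply/rowP => i; rewrite !mxE; ring.
  apply: (le_trans (ler_normD _ _)).
  have := bnd _ v; rewrite lerDl => /(_ w0); lra.
- rewrite (_ : phi (g t') - _ = (phi (g t') - phi (g t) - (t' - t) *: w) + (t' - (t + s)) *: w); last first.
    by apply/rowP => i; rewrite !mxE; ring.
  apply: (le_trans (ler_normD _ _)).
  have := bnd _ w; rewrite lerDr => /(_ v0); lra.
Qed.

End flow_set.

Lemma nonporous_atS {R : realType} {n : nat} (X E F : set 'rV[R]_n) (x : 'rV[R]_n) :
  E `<=` F -> nonporous_at X E x -> nonporous_at X F x.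
Proof.
move=> EF H eta eta0; have [rho rho0 Hrho] := H _ eta0; exists rho => // r rr y Xy xy.
by have [z /EF Fz zy] := Hrho r rr y Xy xy; exists z.
Qed.

Lemma flow_setS {R : realType} {n m : nat} (X : set 'rV[R]_n) (phi : 'rV[R]_n -> 'rV[R]_m)
    v w (e e' d : R) : e <= e' -> flow_set X phi v w e d `<=` flow_set X phi v w e' d.
Proof.
move=> ee x [Xx H]; split => // s sd; have [y [Xy h1 h2]] := H s sd.
by exists y; split => //; [apply: (le_trans h1)|apply: (le_trans h2)]; rewrite ler_wpM2r.
Qed.

Section cone_points.
Context {R : realType} {n m : nat} (X : set 'rV[R]_n).
Variables (phi : 'rV[R]_n -> 'rV[R]_m) (u : 'rV[R]_m) (c : R).

(** A compact exhaustion of the pairs with second component in the cone; the lower bound on the norm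
    excludes limits at 0. *)
Definition cone_pairs (M : nat) : set ('rV[R]_n * 'rV[R]_m) :=
  [set p | [/\ `|p.1| <= M.+1%:R, `|p.2| <= M.+1%:R, M.+1%:R^-1 <= enorm p.2
             & c * enorm p.2 <= dotv p.2 u]].

Lemma cone_pairs_compact M : compact (cone_pairs M).
Proof.
pose A : set 'rV[R]_n := [set v | `|v| <= M.+1%:R].
pose B : set 'rV[R]_m := [set w | `|w| <= M.+1%:R] `&`
  ((@enorm R m) @^-1` [set z | M.+1%:R^-1 <= z] `&`
   (fun w => dotv w u - c * enorm w) @^-1` [set z | 0 <= z]).
have cball k : closed [set v : 'rV[R]_k | `|v| <= M.+1%:R].
  rewrite (_ : [set v | _] = closed_ball_ Num.norm 0 M.+1%:R); last first.
    by apply/seteqP; split => v; rewrite /closed_ball_ /= sub0r normrN.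
  exact: closed_closed_ball_.
have bball k : bounded_set [set v : 'rV[R]_k | `|v| <= M.+1%:R].
  by exists M.+1%:R; split => // z Mz v /= h; apply: (le_trans h); exact: ltW.
have -> : cone_pairs M = A `*` B.
  apply/seteqP; split => [[v w] /= [h1 h2 h3 h4]|[v w] /= [h1 [h2 [h3 h4]]]].
    by split => //; split => //; split => //=; rewrite subr_ge0.
  by split => //; rewrite -subr_ge0.
apply: compact_setX; apply: bounded_closed_compact => //.
- have [M0 [M0r HM0]] := bball m; exists M0; split => // z Mz w [/= + _]; exact: HM0.
- apply: closedI => //; apply: closedI; apply: closed_comp.
  + by move=> w _; exact: enorm_continuous.
  + exact: closed_ge.
  + move=> w _.
    apply: (@continuousB _ _ _ (fun w => dotv w u) (fun w => c * enorm w)).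
      exact: dotv_continuous.
    apply: (@continuousM _ _ (cst c) (@enorm R m)); first exact: cst_continuous.
    exact: enorm_continuous.
  + exact: closed_ge.
Qed.

(** A countable family. One error 1/(j+1) is for the flow, the other for the rational
    approximation. *)
Definition rat_flow_set (j : nat) (a : 'rV[rat]_n * 'rV[rat]_m * nat) : set 'rV[R]_n :=
  flow_set X phi (map_mx ratr a.1.1) (map_mx ratr a.1.2)
    (j.+1%:R^-1 + j.+1%:R^-1) (a.2.+1%:R^-1).

Definition near_cone (M j : nat) : set ('rV[rat]_n * 'rV[rat]_m * nat) :=
  [set a | exists2 p, cone_pairs M p &
     `|p.1 - map_mx ratr a.1.1| <= j.+1%:R^-1 /\ `|p.2 - map_mx ratr a.1.2| <= j.+1%:R^-1].

(** Closures make the set Borel, and [M] is fixed before [j] so that the pairs found for all [j] lie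
    in one compact set. *)
Definition cone_points : set 'rV[R]_n :=
  \bigcup_M \bigcap_j \bigcup_(a in near_cone M j) closure (rat_flow_set j a).

Lemma cone_points_measurable : measurable (cone_points : set (BorRn R n)).
Proof.
apply: bigcupT_measurable => M; apply: bigcapT_measurable => j.
rewrite bigcup_mkcond; apply: countable_bigcupT_measurable => [|a].
  exact: countableP.
case: ifPn => _ //; apply: closed_measurable_BorRn; exact: closed_closure.
Qed.

(** Outside a null set of parameters both the fragment and its image under [phi] are differentiable,
    with the latter derivative in the cone, so the point is a cone point. The exceptional parameters
    have an image of zero length. *)
Lemma fragment_cone_points (G : set (R * 'rV[R]_n)) :
  is_fragment X G -> frag_in_dir phi u c G ->
  hausdorff1 (~` cone_points `&` frag_img G) = 0%E.
Proof.
move=> [C [g [cC _ gX [L [L0 HL]] GE]]] [N0 [N0null HN0]].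
have GP t : C t -> G (t, g t) by move=> Ct; rewrite GE; exists t.
have PG t y : G (t, y) -> C t /\ y = g t by rewrite GE => -[s Cs [<- <-]].
have domG : frag_dom G = C.
  by apply/seteqP; split => t; [move=> [y /PG[]]|move=> Ct; exists (g t); exact: GP].
have gL s t : C s -> C t -> edist (g s) (g t) <= L * `|s - t|.
  by move=> Cs Ct; have [] := HL _ _ Cs Ct.
have gLn s t : C s -> C t -> `|g s - g t| <= L * `|s - t|.
  by move=> Cs Ct; apply: le_trans (gL _ _ Cs Ct); exact: norm_le_enorm.
have [N1 [N1null HN1]] := rV_lipschitz_ae_derivative gLn.
apply: (@hausdorff1_lipschitz_null _ _ C (N0 `|` N1) g L) => //.
  exact: (@negligibleU _ _ _ (@lebesgue_measure R)) N0null N1null.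
move=> y [ngood [t /PG[Ct yE]]]; exists t => //; split => //.
apply: contrapT => /not_orP[nN0 nN1]; apply: ngood; rewrite yE.
have [v Hv] := HN1 _ Ct nN1.
have [|w [[dens Hw] [w0 wcone]]] := HN0 t _ nN0; first by rewrite domG.
rewrite domG in dens.
have ew0 : 0 < enorm w by rewrite (lt_le_trans _ (norm_le_enorm _))// normr_gt0.
have Hw' e : 0 < e -> exists2 d, 0 < d & forall t', C t' -> 0 < `|t' - t| < d ->
     `|phi (g t') - phi (g t) - (t' - t) *: w| <= e * `|t' - t|.
  move=> e0; have [d d0 Hd] := Hw _ e0; exists d => // t' Ct' tt'.
  have tt0 : 0 < `|t' - t| by have /andP[] := tt'.
  have := Hd t' (g t) (g t') (GP _ Ct) (GP _ Ct') tt'.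
  move/(le_lt_trans (norm_le_enorm _)) => h.
  rewrite (_ : phi (g t') - phi (g t) - (t' - t) *: w =
     (t' - t) *: ((t' - t)^-1 *: (phi (g t') - phi (g t)) - w)); last first.
    by rewrite scalerBr scalerA divff ?scale1r// -normr_gt0.
  by rewrite normrZ mulrC ler_wpM2r// ltW.
have Hflow := fragment_flow_set (compact_measurable cC) gX Ct Hv dens Hw'.
have v0 : 0 <= `|v| by []. have nw0 : 0 <= `|w| by [].
have iw0 : 0 < (enorm w)^-1 by rewrite invr_gt0.
pose M := Num.bound (`|v| + `|w| + (enorm w)^-1).
have HM : `|v| + `|w| + (enorm w)^-1 < M.+1%:R.
  apply: (lt_trans (archi_boundP _)); last by rewrite ltr_nat.
  by rewrite !addr_ge0// ltW.
have Kvw : cone_pairs M (v, w).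
  split => //=; [lra|lra|].
  by rewrite invf_ple ?posrE//; lra.
exists M => // j _.
have j0 : 0 < j.+1%:R^-1 :> R by rewrite invr_gt0.
have [d d0 Hd] := Hflow _ j0.
have [q1 Hq1] := rV_rat_approx v j0.
have [q2 Hq2] := rV_rat_approx w j0.
exists (q1, q2, Num.bound d^-1).
  by exists (v, w) => //=; split; exact: ltW.
apply: subset_closure.
have [Xt Hs] := flow_set_perturb Hd (ltW Hq1) (ltW Hq2).
split => // s /= sd; apply: Hs; apply: (lt_le_trans sd).
rewrite invf_ple ?posrE//.
by rewrite ltW// (lt_trans (archi_boundP _)) ?ltr_nat// invr_ge0 ltW.
Qed.

(** Almost every fragment meets the complement in zero length, so its measure [nu G] ignores it;
    then integrate. *)
Lemma alberti_cone_points (mu : meas R n) (P : probability (FragT X) R)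
    (nu : FragT X -> meas R n) :
  alberti_rep X mu P nu -> rep_in_dir X P phi u c -> mu (~` cone_points) = 0%E.
Proof.
move=> [_ [_ Hac _ Hint _]] [N [mN N0 HN]].
have mA : measurable (~` cone_points : set (BorRn R n)).
  by apply: measurableC; exact: cone_points_measurable.
rewrite Hint//; apply: (integral_eq0_off_null mN N0) => G FG //.
move=> NG; apply: Hac => //.
exact: fragment_cone_points (HN _ FG NG).
Qed.

(** A cluster point of the pairs attached to [x] for each [j] is approximated, with arbitrarily
    small error, by directions whose flow sets are non-porous at [x]. *)
Lemma cone_points_flow_dir x : lipschitz_on X phi -> cone_points x ->
  (forall j a, closure (rat_flow_set j a) x -> nonporous_at X (rat_flow_set j a) x) ->
  exists v w, flow_dir X phi x v w /\ in_cone u c w.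
Proof.
move=> Lphi [M _ HM] Hnp.
have /choice[f Hf] : forall j : nat, exists ap : ('rV[rat]_n * 'rV[rat]_m * nat) *
    ('rV[R]_n * 'rV[R]_m), [/\ cone_pairs M ap.2,
    `|ap.2.1 - map_mx ratr ap.1.1.1| <= j.+1%:R^-1,
    `|ap.2.2 - map_mx ratr ap.1.1.2| <= j.+1%:R^-1 &
    closure (rat_flow_set j ap.1) x].
  by move=> j; have [a [p Kp [h1 h2]] ca] := HM j I; exists (a, p).
have FK : ((fun j => (f j).2) @ \oo) (cone_pairs M).
  by exists 0%N => // j _ /=; have [] := Hf j.
have [[v w] [Kvw clus]] := @cone_pairs_compact M _ _ FK.
exists v, w; split; last first.
  have [/= _ _ h3 h4] := Kvw; split => //; apply/eqP => w0.
  move: h3; rewrite w0 /enorm /dotv big1 ?sqrtr0; last by move=> i _; rewrite mxE mul0r.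
  by rewrite leNgt invr_gt0 ltr0Sn.
apply: flow_dir_of_flow_sets => // e e0.
have e20 : 0 < e / 2 by rewrite divr_gt0.
pose J := Num.bound (e / 2)^-1.
have HJ j : (J <= j)%N -> j.+1%:R^-1 <= e / 2.
  move=> Jj; rewrite invf_ple ?posrE//.
  rewrite (@le_trans _ _ J%:R) ?ler_nat//; last exact: (leq_trans Jj).
  by rewrite ltW// archi_boundP// invr_ge0 ltW.
(* Clustering provides an index [j] beyond [J] whose pair is within [e / 2] of the limit; the
   rational approximation costs another [e / 2]. *)
have [||p [[j /= Jj <-] [hv hw]]] := clus [set (f j).2 | j in [set j | (J <= j)%N]] (ball v (e / 2) `*` ball w (e / 2)).
- by exists J => // j Jj; exists j.
- by exists (ball v (e / 2), ball w (e / 2)) => //; split; exact: nbhsx_ballx.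
have [_ h1 h2 cl] := Hf j.
exists (map_mx ratr (f j).1.1.1), (map_mx ratr (f j).1.1.2), ((f j).1.2.+1%:R^-1).
have hj := HJ _ Jj.
move: hv hw; rewrite /= !ball_norm_lt => hv hw.
split.
- by rewrite invr_gt0.
- rewrite -[v](subrK (f j).2.1) -addrA.
  apply: (le_trans (ler_normD _ _)); rewrite [e]splitr.
  by apply: lerD; [exact: ltW|exact: le_trans hj].
- rewrite -[w](subrK (f j).2.2) -addrA.
  apply: (le_trans (ler_normD _ _)); rewrite [e]splitr.
  by apply: lerD; [exact: ltW|exact: le_trans hj].
- apply: nonporous_atS (Hnp _ _ cl); apply: flow_setS.
  by rewrite [e]splitr; exact: lerD.
Qed.

End cone_points.

(** * Assembling the invariant subspace at almost every point *)

Set Strict Implicit.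
Unset Implicit Arguments.

Theorem theorem1p2 (R : realType) (n k : nat) (X : set 'rV[R]_n)
    (mu0 mu : {measure set (BorRn R n) -> \bar R}) :
  (1 <= k)%N ->
  closed X ->
  doubling_on X mu0 ->
  radon_on X mu ->
  mu `<< mu0 ->
  mu setT <> 0%E ->
  has_indep_alberti X mu k ->
  exists N : set (BorRn R n),
    [/\ measurable N, mu N = 0%E &
      forall x : 'rV[R]_n, X x -> ~ N x ->
        exists V : 'M[R]_n,
          \rank V = k /\
          forall Y : set 'rV[R]_n, intrinsic_tangent X x Y ->
            exists Z : set 'rV[R]_n,
              [/\ closed Z, Z `<=` orth_compl V &
                  Y = [set z + v | z in Z & v in [set v : 'rV[R]_n | (v <= V)%MS]]]].
Proof.
move=> _ _ dmu0 _ /null_content_dominatesP ac _.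
move=> [m [phi [u [c [P [nu [Lphi _ indep Halb Hdir]]]]]]].
have /choice[Q HQ] : forall ja : nat * ('rV[rat]_n * 'rV[rat]_m * nat),
    exists N : set (BorRn R n), mu0.-negligible N /\
      forall x, X x -> closure (rat_flow_set X phi ja.1 ja.2) x -> ~ N x ->
        nonporous_at X (rat_flow_set X phi ja.1 ja.2) x.
  by move=> ja; exact: doubling_ae_nonporous.
have [B [mB B0 QB]] : mu0.-negligible (\bigcup_ja Q ja).
  by apply: negligible_bigcup_countType => ja; have [] := HQ ja.
have mC i : measurable (~` cone_points X phi (u i) (c i) : set (BorRn R n)).
  by apply: measurableC; exact: cone_points_measurable.
(* Porosity is null for [mu0], hence for [mu] by absolute continuity; missing cone points are null
   for [mu] directly. *)
have [N [mN N0 NB]] : mu.-negligible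
    (B `|` \bigcup_i (~` cone_points X phi (u i) (c i) : set (BorRn R n))).
  apply: negligibleU; first by exists B; split => //; exact: ac.
  apply: negligible_bigcup_countType => i; exists (~` cone_points X phi (u i) (c i)).
  by split => //; exact: alberti_cone_points (Halb i) (Hdir i).
exists N; split => // x Xx Nx.
have /choice[v /choice[w Hvw]] : forall i, exists v w,
    flow_dir X phi x v w /\ in_cone (u i) (c i) w.
  move=> i; apply: cone_points_flow_dir => //.
    by apply: contrapT => nx; apply/Nx/NB; right; exists i.
  move=> j a cl; have [_ /(_ x Xx cl)] := HQ (j, a); apply => Qx.
  by apply/Nx/NB; left; apply: QB; exists (j, a).
pose V := \matrix_(i < k, j < n) v i 0 j.
pose W := \matrix_(i < k, j < m) w i 0 j.
have flowVW a : flow_dir X phi x (a *m V) (a *m W).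
  apply: flow_dir_mulmx => i; have [+ _] := Hvw i.
  by congr flow_dir; apply/rowP => j; rewrite !mxE.
have freeW : row_free W by apply: indep => i; have [] := Hvw i.
(* A relation [a] among the rows of [V] gives a flow direction 0 along which [phi] changes at rate
   [a *m W]; this rate vanishes, and so does [a]. *)
have freeV : row_free V.
  rewrite -kermx_eq0; apply/rowV0P => a; rewrite sub_kermx => /eqP aV.
  have := flowVW a; rewrite aV => /(flow_dir_eq0 Lphi Xx) aW.
  by move: freeW; rewrite -kermx_eq0 => /rowV0P; apply; rewrite sub_kermx aW.
(* The square matrix [<<V>>] has the row space of the [k] by [n] matrix [V]. *)
exists <<V>>%MS; split; first by rewrite genmxE; exact/eqP.
move=> Y tanY; apply: translation_invariant_product.
  by have [lam [_ _ []]] := tanY.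
move=> y z Yy; rewrite genmxE => /submxP[a ->].
exact: tangent_translate (flowVW a) tanY Yy.
Qed.
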